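(* Let $\omega$ be a subadditive weight, let $a>2$ and let $\sigma(t)=\omega(t^{1/a})$ for $t\ge 0$. Let $\psi$ be a polynomial with real coefficients of degree greater than one, and for $m\in\mathbb{N}$ let $\psi_m=\psi\circ\overset{(m)}{\cdots}\circ\psi$ be its $m$-th iterate. Then the following statements are equivalent: (1) the sequence $(C_{\psi_m})_{m\in\mathbb{N}}$ is equicontinuous in $\mathcal{L}(\mathcal{S}_\omega(\mathbb{R}),\mathcal{S}_\sigma(\mathbb{R}))$; (2) the sequence $(C_{\psi_m})_{m\in\mathbb{N}}$ is equicontinuous in $\mathcal{L}(\mathcal{S}_\omega(\mathbb{R}),\mathcal{S}(\mathbb{R}))$; (3) $\psi$ lacks fixed points, i.e. there is no $x\in\mathbb{R}$ with $\psi(x)=x$.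
   Context: $\mathbb{N}=\{1,2,\dots\}$, $\mathbb{N}_0=\mathbb{N}\cup\{0\}$. A weight is a continuous increasing function $\omega:[0,\infty[\to[0,\infty[$ such that: $(\alpha)$ there is $K\ge 1$ with $\omega(2t)\le K(\omega(t)+1)$ for all $t\ge 0$; $(\beta)$ $\int_0^\infty \frac{\omega(t)}{1+t^2}\,dt<\infty$; $(\gamma)$ $\log(1+t^2)=o(\omega(t))$ as $t\to\infty$; $(\delta)$ $\varphi_\omega(t):=\omega(e^t)$ is convex. It is subadditive if $\omega(s+t)\le\omega(s)+\omega(t)$ for all $s,t\ge 0$. The Young conjugate of $\varphi_\omega$ is $\varphi_\omega^*(s)=\sup\{st-\varphi_\omega(t): t\ge 0\}$, $s\ge 0$. The Gelfand-Shilov space of Beurling type $\mathcal{S}_\omega(\mathbb{R})$ is the space of all $f\in C^\infty(\mathbb{R})$ (complex valued) with $$\|f\|_{\omega,\lambda}:=\sup_{x\in\mathbb{R}}\sup_{n,q\in\mathbb{N}_0}(1+|x|)^q|f^{(n)}(x)|\exp\left(-\lambda\varphi_\omega^*\left(\tfrac{n+q}{\lambda}\right)\right)<\infty\quad\text{for every }\lambda>0,$$ a Fréchet space with the topology given by these seminorms. $\mathcal{S}(\mathbb{R})$ is the Schwartz space with its usual Fréchet topology. $C_\phi$ is the composition operator $f\mapsto f\circ\phi$. $\mathcal{L}(X,Y)$ is the space of continuous linear operators from $X$ to $Y$. For a subadditive weight $\omega$ and $\sigma$ as in the statement, it is known that every $C_{\psi_m}$ maps $\mathcal{S}_\omega(\mathbb{R})$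 continuously into $\mathcal{S}_\sigma(\mathbb{R})$. *)

(* Defs.v *)
Set Warnings "-notation-overridden,-ambiguous-paths,-notation-incompatible-prefix,-redundant-canonical-projection,-projection-no-head-constant".
From HB Require Import structures.
From mathcomp Require Import all_boot all_order all_algebra.
From mathcomp Require Import all_classical all_reals all_analysis.
From mathcomp Require Import complex.

Set Implicit Arguments.
Unset Strict Implicit.
Unset Printing Implicit Defensive.

Import Order.TTheory GRing.Theory Num.Theory.
Import numFieldNormedType.Exports.

Local Open Scope ring_scope.
Local Open Scope classical_set_scope.

Notation cabs := ComplexField.Normc.normc.

Canonical pinfty_filter_on (R : numFieldType) :=
  FilterType (pinfty_nbhs R) _.

Section weights.
Variable R : realType.
Implicit Types (w : R -> R) (s t : R).

Definition phi w t : R := w (expR t).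

(* Weights are functions on [0, +oo[, represented by functions on R whose
   values at negative arguments are irrelevant. "Increasing" is understood in
   the wide sense. *)
Record weight w : Prop := Weight {
  weight_ge0 : forall t, 0 <= t -> 0 <= w t;
  weight_continuous : {within `[0, +oo[, continuous w};
  weight_increasing : {in `[0, +oo[ &, {homo w : s t / s <= t}};
  weight_alpha : exists2 K, 1 <= K &
    forall t, 0 <= t -> w (2 * t) <= K * (w t + 1);
  weight_beta :
    (\int[lebesgue_measure]_(t in `[0%R, +oo[) (w t / (1 + t ^+ 2))%:E < +oo)%E;
  weight_gamma : (fun t => ln (1 + t ^+ 2) : R^o) =o_ (pinfty_nbhs R) (w : R -> R^o);
  weight_delta : convex_function (E := R^o) setT (phi w) }.

Definition weight_subadditive w :=
  forall s t, 0 <= s -> 0 <= t -> w (s + t) <= w s + w t.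

(* By (gamma), the supremum is over a set bounded above when w is a weight and
   s >= 0. *)
Definition young w s : R :=
  sup [set s * t - phi w t | t in `[0, +oo[].

End weights.

Section seminormed.
Variables (R : realType) (E : lmodType R[i]).

(* Every [sn_fun i] is a [0, +oo]-valued seminorm: nonnegativity follows from
   the two axioms. *)
Record seminorms := Seminorms {
  sn_index : eqType;
  sn_fun :> sn_index -> E -> \bar R;
  sn_Z : forall i (c : R[i]) f, sn_fun i (c *: f) = ((cabs c)%:E * sn_fun i f)%E;
  sn_D : forall i f g, (sn_fun i (f + g)%R <= sn_fun i f + sn_fun i g)%E }.

Variable S : seminorms.

Lemma sn_0 i : S i 0 = 0%E.
Proof.
by rewrite -(scale0r (0 : E)) sn_Z ComplexField.Normc.normc0 mul0e.
Qed.

Lemma sn_B i f g : S i (f - g) = S i (g - f).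
Proof.
rewrite -[f - g]opprB -[- (g - f)]scaleN1r sn_Z normcN.
by rewrite ComplexField.Normc.normc1 mul1e.
Qed.

Definition finite_sn : {pred E} := fun f => `[< forall i, (S i f < +oo)%E >].

Record lcspace := LCSpace { lcval :> E; _ : lcval \in finite_sn }.

HB.instance Definition _ := [isSub for lcval].
HB.instance Definition _ := [Choice of lcspace by <:].

Lemma finite_sn_submod : submod_closed finite_sn.
Proof.
split; first by apply/asboolP => i; rewrite sn_0.
move=> c f g /asboolP finf /asboolP fing; apply/asboolP => i.
apply: (le_lt_trans (sn_D _ _ _)); apply: lte_add_pinfty (fing i).
rewrite sn_Z; have [->|c0] := eqVneq c 0.
  by rewrite ComplexField.Normc.normc0 mul0e.
by apply: lte_mul_pinfty => //; rewrite lee_fin; case: (c) => a b; exact: sqrtr_ge0.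
Qed.

HB.instance Definition _ :=
  GRing.isSubmodClosed.Build _ _ finite_sn finite_sn_submod.
HB.instance Definition _ := [SubChoice_isSubLmodule of lcspace by <:].
HB.instance Definition _ := isPointed.Build lcspace 0.

(* The locally convex uniformity: the sets below, for s a finite list of indices
   and e > 0, are a base of it, and the balls around 0 they define are a base of
   neighborhoods of 0. *)
Definition sn_ball (s : seq (sn_index S)) (e : R) : set (lcspace * lcspace) :=
  [set fg | forall i, i \in s -> (S i (lcval fg.1 - lcval fg.2)%R < e%:E)%E].

Definition sn_entourage : set_system (lcspace * lcspace) :=
  [set A | exists s, exists2 e, 0 < e & sn_ball s e `<=` A].

Lemma sn_entourage_filter : Filter sn_entourage.
Proof.
split.
- by exists [::], 1.
- move=> A B [s [e e0 sA]] [t [d d0 tB]].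
  exists (s ++ t), (Num.min e d); first by rewrite lt_min e0.
  move=> fg fgP; split; [apply: sA|apply: tB] => i ist.
    have := fgP i; rewrite mem_cat ist => /(_ isT)/lt_le_trans; apply.
    by rewrite lee_fin ge_min lexx.
  have := fgP i; rewrite mem_cat ist orbT => /(_ isT)/lt_le_trans; apply.
  by rewrite lee_fin ge_min lexx orbT.
- by move=> A B AB [s [e e0 sA]]; exists s, e => // fg /sA/AB.
Qed.

Lemma sn_entourage_diagonal A : sn_entourage A -> (diagonal `<=` A)%relation.
Proof.
move=> [s [e e0 sA]] [f g] /= fg; apply: sA => i _ /=.
by rewrite (fg : f = g) subrr sn_0 lte_fin.
Qed.

Lemma sn_entourage_inv A : sn_entourage A -> sn_entourage (A^-1)%relation.
Proof.
move=> [s [e e0 sA]]; exists s, e => // -[f g] fgP; apply: sA => i ist /=.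
by rewrite sn_B; exact: fgP.
Qed.

Lemma sn_entourage_split A : sn_entourage A ->
  exists2 B, sn_entourage B & (B \; B `<=` A)%relation.
Proof.
move=> [s [e e0 sA]]; exists (sn_ball s (e / 2)).
  by exists s, (e / 2) => //; rewrite divr_gt0.
move=> [f g] [h fh hg]; apply: sA => i ist /=.
rewrite -(subrK (lcval h) (lcval f)) -addrA (splitr e) EFinD.
by apply: (le_lt_trans (sn_D _ _ _)); apply: lteD; [exact: fh|exact: hg].
Qed.

HB.instance Definition _ := isUniform.Build lcspace sn_entourage_filter
  sn_entourage_diagonal sn_entourage_inv sn_entourage_split.

End seminormed.

Section smooth.
Variable R : realType.
Local Notation cRe := (@complex.Re R).
Local Notation cIm := (@complex.Im R).
Implicit Types (f g : R -> R[i]) (u v : R -> R).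

Definition rsmooth u := forall n x, derivable (derive1n n u) x 1.

Definition csmooth : {pred R -> R[i]} := fun f =>
  `[< rsmooth (cRe \o f) /\ rsmooth (cIm \o f) >].

(* The derivative of a complex-valued function of a real variable is taken
   componentwise. *)
Definition cderiv n f (x : R) : R[i] :=
  Complex ((cRe \o f)^`(n) x) ((cIm \o f)^`(n) x).

Lemma derivable_comb (a b : R) u v (x : R) :
  derivable u x 1 -> derivable v x 1 ->
  derivable (fun y => a * u y + b * v y) x 1.
Proof.
by move=> du dv; exact: (derivableD (derivableZ (k := a) du) (derivableZ (k := b) dv)).
Qed.

Lemma derive1_comb (a b : R) u v (x : R) :
  derivable u x 1 -> derivable v x 1 ->
  derive1 (fun y => a * u y + b * v y) x = a * derive1 u x + b * derive1 v x.
Proof.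
move=> du dv; rewrite !derive1E.
have := deriveD (derivableZ (k := a) du) (derivableZ (k := b) dv).
by rewrite (deriveZ a du) (deriveZ b dv); exact.
Qed.

Lemma derive1n_comb (a b : R) u v n : rsmooth u -> rsmooth v ->
  derive1n n (fun x => a * u x + b * v x) =
  fun x => a * derive1n n u x + b * derive1n n v x.
Proof.
move=> su sv; elim: n => [//|n IH]; rewrite !derive1nS IH; apply/funext => x.
exact: (derive1_comb a b (su n x) (sv n x)).
Qed.

Lemma rsmooth_comb (a b : R) u v : rsmooth u -> rsmooth v ->
  rsmooth (fun x => a * u x + b * v x).
Proof.
move=> su sv n x; rewrite (derive1n_comb _ _ _ su sv).
exact: (derivable_comb (su n x) (sv n x)).
Qed.

Lemma Re_comb (c : R[i]) f : cRe \o (c *: f) =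
  fun x => cRe c * (cRe \o f) x + (- cIm c) * (cIm \o f) x.
Proof.
apply/funext => x; rewrite -[LHS]/(cRe (c * f x)) /=.
by case: c => a b; case: (f x) => d e /=; rewrite mulNr.
Qed.

Lemma Im_comb (c : R[i]) f : cIm \o (c *: f) =
  fun x => cRe c * (cIm \o f) x + cIm c * (cRe \o f) x.
Proof.
apply/funext => x; rewrite -[LHS]/(cIm (c * f x)) /=.
by case: c => a b; case: (f x).
Qed.

Lemma ReD f g : cRe \o (f + g) = fun x => 1 * (cRe \o f) x + 1 * (cRe \o g) x.
Proof.
apply/funext => x; rewrite !mul1r -[LHS]/(cRe (f x + g x)) /=.
by case: (f x); case: (g x).
Qed.

Lemma ImD f g : cIm \o (f + g) = fun x => 1 * (cIm \o f) x + 1 * (cIm \o g) x.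
Proof.
apply/funext => x; rewrite !mul1r -[LHS]/(cIm (f x + g x)) /=.
by case: (f x); case: (g x).
Qed.

Lemma csmooth_submod : submod_closed csmooth.
Proof.
have smoothZ c f : f \in csmooth -> c *: f \in csmooth.
  move=> /asboolP[sr si]; apply/asboolP; rewrite Re_comb Im_comb; split.
    exact: (rsmooth_comb sr si).
  exact: (rsmooth_comb si sr).
split.
  have s0 : rsmooth (cst 0).
    move=> n x; suff -> : (cst 0)^`(n) = cst (0 : R) :> (R -> R).
      exact: derivable_cst.
    elim: n => // n IH; rewrite derive1nS IH; apply/funext => y.
    exact: derive1_cst.
  by apply/asboolP; split; exact: s0.
move=> c f g /(smoothZ c) /asboolP[cr ci] /asboolP[gr gi]; apply/asboolP.
rewrite ReD ImD.
by split; [exact: (rsmooth_comb (a := 1) (b := 1) cr gr)|exact: (rsmooth_comb (a := 1) (b := 1) ci gi)].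
Qed.

HB.instance Definition _ :=
  GRing.isSubmodClosed.Build _ _ csmooth csmooth_submod.

Record smoothfun := SmoothFun { smoothval :> R -> R[i]; _ : smoothval \in csmooth }.

HB.instance Definition _ := [isSub for smoothval].
HB.instance Definition _ := [Choice of smoothfun by <:].
HB.instance Definition _ := [SubChoice_isSubLmodule of smoothfun by <:].

Lemma cderivZ n (c : R[i]) (f : smoothfun) x :
  cderiv n (c *: f) x = c * cderiv n f x.
Proof.
have /asboolP[sr si] : smoothval f \in csmooth by case: f.
rewrite /cderiv (Re_comb c f) (Im_comb c f).
rewrite (derive1n_comb _ _ _ sr si) (derive1n_comb _ _ _ si sr).
by case: c => a b; rewrite /= mulNr.
Qed.

Lemma cderivD n (f g : smoothfun) x :
  cderiv n (f + g) x = cderiv n f x + cderiv n g x.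
Proof.
have /asboolP[sfr sfi] : smoothval f \in csmooth by case: f.
have /asboolP[sgr sgi] : smoothval g \in csmooth by case: g.
rewrite /cderiv (ReD f g) (ImD f g).
by rewrite (derive1n_comb _ _ _ sfr sgr) (derive1n_comb _ _ _ sfi sgi) !mul1r.
Qed.

Section weighted_sup.
Variables (J : pointedType) (c : J -> R) (n : J -> nat) (x : J -> R).
Hypothesis c_ge0 : forall j, 0 <= c j.

Definition wsup (f : R -> R[i]) : \bar R :=
  ereal_sup (range (fun j => (c j * cabs (cderiv (n j) f (x j)))%:E)).

Lemma wsupZ (a : R[i]) (f : smoothfun) :
  wsup (a *: f) = ((cabs a)%:E * wsup f)%E.
Proof.
have a0 : 0 <= cabs a by case: (a) => ? ?; exact: sqrtr_ge0.
rewrite /wsup -ereal_supZl//; last first.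
  by apply/set0P; exists (c point * cabs (cderiv (n point) f (x point)))%:E, point.
congr ereal_sup; rewrite image_comp; congr image; apply/funext => j.
rewrite -[LHS]/((c j * cabs (cderiv (n j) (a *: f) (x j)))%:E) cderivZ.
by rewrite /= ComplexField.Normc.normcM -EFinM mulrCA.
Qed.

Lemma wsupD (f g : smoothfun) : (wsup (f + g)%R <= wsup f + wsup g)%E.
Proof.
apply: ge_ereal_sup => _ [j _ <-]; rewrite cderivD.
apply: (@le_trans _ _ ((c j * cabs (cderiv (n j) f (x j)))%:E +
                       (c j * cabs (cderiv (n j) g (x j)))%:E)%E).
  by rewrite -EFinD lee_fin -mulrDr ler_wpM2l// le_normcD.
by apply: leeD; apply: ereal_sup_ubound; exists j.
Qed.

End weighted_sup.

Definition gs_norm (w : R -> R) (l : {posnum R}) f : \bar R :=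
  ereal_sup [set r | exists x n q, r =
    ((1 + `|x|) ^+ q * cabs (cderiv n f x) *
     expR (- (l%:num * young w ((n + q)%:R / l%:num))))%:E].

Definition schwartz_norm (nq : nat * nat) f : \bar R :=
  ereal_sup [set r | exists x, r =
    (`|x| ^+ nq.2 * cabs (cderiv nq.1 f x))%:E].

Lemma gs_normE w l : gs_norm w l = @wsup (R * nat * nat)%type
  (fun j => (1 + `|j.1.1|) ^+ j.2 *
            expR (- (l%:num * young w ((j.1.2 + j.2)%:R / l%:num))))
  (fun j => j.1.2) (fun j => j.1.1).
Proof.
apply/funext => f; congr ereal_sup; apply/seteqP; split => r.
  by move=> [x [n [q ->]]]; exists (x, n, q) => //=; rewrite mulrAC.
by move=> [[[x n] q] _ <-]; exists x, n, q => /=; rewrite mulrAC.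
Qed.

Lemma schwartz_normE nq : schwartz_norm nq =
  @wsup R (fun x => `|x| ^+ nq.2) (fun=> nq.1) id.
Proof.
apply/funext => f; congr ereal_sup; apply/seteqP; split => r.
  by move=> [x ->]; exists x.
by move=> [x _ <-]; exists x.
Qed.

Lemma gs_normZ w l (c : R[i]) (f : smoothfun) :
  gs_norm w l (c *: f) = ((cabs c)%:E * gs_norm w l f)%E.
Proof. by rewrite gs_normE; exact: wsupZ. Qed.

Lemma gs_normD w l (f g : smoothfun) :
  (gs_norm w l (f + g)%R <= gs_norm w l f + gs_norm w l g)%E.
Proof.
by rewrite gs_normE; apply: wsupD => j; rewrite mulr_ge0 ?expR_ge0 ?exprn_ge0.
Qed.

Lemma schwartz_normZ nq (c : R[i]) (f : smoothfun) :
  schwartz_norm nq (c *: f) = ((cabs c)%:E * schwartz_norm nq f)%E.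
Proof. by rewrite schwartz_normE; exact: wsupZ. Qed.

Lemma schwartz_normD nq (f g : smoothfun) :
  (schwartz_norm nq (f + g)%R <= schwartz_norm nq f + schwartz_norm nq g)%E.
Proof. by rewrite schwartz_normE; apply: wsupD => j; rewrite exprn_ge0. Qed.

Definition gelfand_shilov w : seminorms smoothfun :=
  Seminorms (gs_normZ w) (gs_normD w).

Definition schwartz : seminorms smoothfun :=
  Seminorms schwartz_normZ schwartz_normD.

(* The operators T m are determined by the first clause, for m >= 1; their
   existence says that each composition operator maps X into Y. *)
Definition equicontinuous_composition (X Y : seminorms smoothfun)
    (h : nat -> R -> R) : Prop :=
  exists T : nat -> {linear lcspace X -> lcspace Y},
    [/\ forall m, (0 < m)%N -> forall F : lcspace X,
          smoothval (lcval (T m F)) = smoothval (lcval F) \o h m,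
        forall m, (0 < m)%N -> continuous (T m) &
        equicontinuous [set m | (0 < m)%N] (fun m => T m : _ -> _)].

End smooth.

(* Main.v *)
(* Write M_l(s) = exp (l phi*(s / l)). Then M_l is nondecreasing, with
   M_l(s) M_l(t) <= M_l(s + t) and M_(2l)(s + t) <= M_l(s) M_l(t); it absorbs
   geometric factors and (as omega is subadditive) factorials, and the norms of
   S_sigma are those of S_omega with M_l(s) replaced by M_l(a s).

   If psi has no fixed point, all orbits escape uniformly and then grow faster
   than any geometric sequence, whereas the j-th Taylor coefficient of psi_m at x
   is at most K^(mj) (1 + |psi_m(x)|) with K independent of m and x; so K^m is
   O((1 + |psi_m(x)|)^e) for every e > 0. By Faa di Bruno's formula the term of
   (f o psi_m)^(n) containing f^(k) is bounded by n!/k! C^n |y|^(k + e n) |f^(k)(y)|,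
   y = psi_m(x), hence by M_l((n - k) + 2k + e n) up to geometric factors, and a > 2
   leaves room for e.

   If psi has a fixed point, apply equicontinuity to a Gaussian G: the functions
   G o psi_m are equi-Lipschitz. On bounded orbits they stay above some c > 0, on
   the other orbits they come arbitrarily close to 0, so the set of points with
   bounded orbit, which is nonempty, would contain a neighborhood of fixed size of
   each of its points and thus be all of R; but large points escape. *)
From HB Require Import structures.
Require Import Defs.
From mathcomp Require Import all_boot all_order all_algebra.
From mathcomp Require Import all_classical all_reals all_analysis.
From mathcomp Require Import complex ring lra zify.

Set Implicit Arguments.
Unset Strict Implicit.
Unset Printing Implicit Defensive.

Import Order.TTheory GRing.Theory Num.Theory.
Import numFieldNormedType.Exports.

Local Open Scope ring_scope.
Local Open Scope classical_set_scope.

(** * The Young conjugate *)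

Section young_conjugate.
Variables (R : realType) (w : R -> R).
Hypothesis w_weight : weight w.

(** The logarithm of the quantity [M_l(s)] of the overview. *)
Definition scaled_young (l s : R) : R := l * young w (s / l).

Lemma phi_ge0 t : 0 <= phi w t.
Proof. exact: (weight_ge0 w_weight (expR_ge0 t)). Qed.

(** Condition (gamma) at the point [expR t], where [ln (1 + expR t ^+ 2)] is at least [2 * t]. It
    makes the suprema defining the Young conjugate finite. *)
Lemma phi_dominates_linear (c : R) : 0 < c ->
  exists2 T, 0 <= T & forall t, T <= t -> t <= c * phi w t.
Proof.
move=> c0.
have /eqoP /(_ c c0) := weight_gamma w_weight.
move=> [M [Mr Mw]].
exists (Num.max 0 (Num.max M (ln (Num.max 1 (M + 1))))); first by rewrite le_max lexx.
move=> t; rewrite !ge_max => /and3P[t0 tM tM1].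
have tE : M < expR t.
  apply: (@lt_le_trans _ _ (M + 1)); first by rewrite ltrDl.
  apply: (@le_trans _ _ (Num.max 1 (M + 1))); first by rewrite le_max lexx orbT.
  by rewrite -ler_expR lnK in tM1 => //; rewrite posrE lt_max ltr01.
have := Mw _ tE.
rewrite [`|w _|]ger0_norm; last exact: phi_ge0.
apply: le_trans; apply: le_trans (ler_norm _).
apply: (@le_trans _ _ (ln (expR t ^+ 2))).
  rewrite -expRM_natl expRK; move: t0; lra.
by rewrite ler_ln ?posrE ?exprn_gt0 ?expR_gt0 ?ltr_wpDr // ?addr_gt0 ?exprn_gt0 ?expR_gt0 // lerDr.
Qed.

Lemma young_has_sup s : 0 <= s ->
  has_sup [set s * t - phi w t | t in `[0, +oo[].
Proof.
move=> s0; split; first by exists (s * 0 - phi w 0), 0 => //=; rewrite in_itv /= lexx.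
have [T T0 Tw] : exists2 T, 0 <= T & forall t, T <= t -> s * t <= phi w t.
  have s1 : 0 < s + 1 by rewrite ltr_wpDl.
  have [|T T0 Tw] := @phi_dominates_linear (s + 1)^-1; first by rewrite invr_gt0.
  exists T => // t /[dup] Tt /Tw; rewrite ler_pdivlMl// => /(le_trans _); apply.
  by apply: ler_wpM2r; [exact: le_trans Tt|rewrite lerDl].
exists (s * T) => y [t /=]; rewrite in_itv /= andbT => t0 <-.
have [tT|/ltW/Tw tT] := leP t T.
  by rewrite lerBlDr ler_wpDr ?phi_ge0// ler_wpM2l.
apply: (@le_trans _ _ 0); last exact: mulr_ge0.
by rewrite subr_le0.
Qed.

Lemma scaled_young_ge l s t : 0 < l -> 0 <= s -> 0 <= t ->
  s * t - l * phi w t <= scaled_young l s.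
Proof.
move=> l0 s0 t0.
rewrite /scaled_young -ler_pdivrMl// mulrBr mulrA [l^-1 * s]mulrC mulKf ?gt_eqF//.
apply: ub_le_sup; last by exists t => //=; rewrite in_itv /= t0.
by have [] := @young_has_sup (s / l) (divr_ge0 s0 (ltW l0)).
Qed.

Lemma scaled_young_le l s b : 0 < l -> 0 <= s ->
  (forall t, 0 <= t -> s * t - l * phi w t <= b) -> scaled_young l s <= b.
Proof.
move=> l0 s0 sb; rewrite /scaled_young -ler_pdivlMl//.
apply: ge_sup; first by have [] := @young_has_sup (s / l) (divr_ge0 s0 (ltW l0)).
move=> y [t /=]; rewrite in_itv /= andbT => t0 <-.
by rewrite ler_pdivlMl// mulrBr mulrA mulrCA divff ?gt_eqF// mulr1 sb.
Qed.

Lemma scaled_young_homo l s t : 0 < l -> 0 <= s -> s <= t ->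
  scaled_young l s <= scaled_young l t.
Proof.
move=> l0 s0 st; apply: scaled_young_le => // u u0.
apply: le_trans (scaled_young_ge l0 (le_trans s0 st) u0).
by rewrite lerD2r ler_wpM2r.
Qed.

(** If [u] and [v] are tested on the left, [Num.max u v] is tested on the right: it only increases
    the linear terms, and its [phi] is one of [phi w u], [phi w v], the other being nonnegative. *)
Lemma scaled_young_superadd l s t : 0 < l -> 0 <= s -> 0 <= t ->
  scaled_young l s + scaled_young l t <= scaled_young l (s + t).
Proof.
move=> l0 s0 t0; have st0 := addr_ge0 s0 t0.
rewrite -lerBrDr; apply: scaled_young_le => // u u0.
rewrite lerBrDr -lerBrDl; apply: scaled_young_le => // v v0.
rewrite lerBrDl.
apply: le_trans (scaled_young_ge l0 st0 (_ : 0 <= Num.max u v)); last first.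
  by rewrite le_max u0.
have lu := mulr_ge0 (ltW l0) (phi_ge0 u); have lv := mulr_ge0 (ltW l0) (phi_ge0 v).
case: (leP u v) => uv; rewrite mulrDl.
  have := ler_wpM2l s0 uv; lra.
have := ler_wpM2l t0 (ltW uv); lra.
Qed.

(** The same [u] is tested in both suprema on the right; the two terms [l * phi w u] account for the
    factor 2. *)
Lemma scaled_young_subadd l s t : 0 < l -> 0 <= s -> 0 <= t ->
  scaled_young (2 * l) (s + t) <= scaled_young l s + scaled_young l t.
Proof.
move=> l0 s0 t0; apply: scaled_young_le; rewrite ?mulr_gt0 ?addr_ge0// => u u0.
apply: le_trans (lerD (scaled_young_ge l0 s0 u0) (scaled_young_ge l0 t0 u0)).
lra.
Qed.

Lemma expr_le_young l e (c : R) : 0 < l -> 0 < e -> 1 <= c ->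
  exists2 C, 0 < C &
    forall n, c ^+ n <= C * expR (scaled_young l (e * n%:R)).
Proof.
move=> l0 e0 c1; have c0 : 0 < c by apply: lt_le_trans c1.
exists (expR (l * phi w (ln c / e))); first exact: expR_gt0.
move=> n; rewrite -expRD -{1}[c]lnK ?posrE// -expRM_natl ler_expR -lerBlDl.
have t0 : 0 <= ln c / e by rewrite divr_ge0 ?ln_ge0// ltW.
apply: le_trans (scaled_young_ge l0 _ t0); last by rewrite mulr_ge0// ltW.
by rewrite lerD2r -mulrA [_%:R * (_ / e)]mulrC mulrA mulrCA divff ?gt_eqF// mulr1 mulrC.
Qed.

(** Substitute [a * t] for [t]. This is how [sigma] enters: its conjugate is that of [omega] at a
    dilated argument. *)
Lemma young_scale_powR (a : R) s : 0 < a ->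
  young (fun t : R => w (t `^ a^-1)) s = young w (a * s).
Proof.
move=> a0; congr sup; apply/seteqP; split => _ [t /= t0 <-].
  exists (t / a) => /=.
    by move: t0; rewrite !in_itv /= !andbT => t0; rewrite divr_ge0// ltW.
  by rewrite /phi -expRM; congr (_ - _); rewrite mulrC mulrA divfK ?gt_eqF// mulrC.
exists (a * t).
  by move: t0; rewrite /= !in_itv /= !andbT => t0; rewrite mulr_ge0// ltW.
by rewrite /phi -expRM mulrCA mulrA [a * t]mulrC mulfK ?gt_eqF.
Qed.

Lemma leq_fact_expn n : (n`! <= n ^ n)%N.
Proof.
elim: n => // n IH; rewrite factS expnS leq_mul2l /=.
by apply: (leq_trans IH); case: n {IH} => // n; rewrite leq_exp2r.
Qed.

Hypothesis w_subadditive : weight_subadditive w.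

Lemma weight_natr_le n : (0 < n)%N -> w n%:R <= n%:R * w 1.
Proof.
elim: n => // -[|n] IH _; first by rewrite mul1r.
rewrite -natr1 mulrDl mul1r.
by apply: (le_trans (w_subadditive _ _)) => //; rewrite lerD2r IH.
Qed.

(** Test [t = ln n] in the supremum: subadditivity gives [w n <= n * w 1], and [n! <= n ^ n]. The
    extra factor in the exponent [n.+1] serves [n = 0], where the conjugate may be as low as
    [- w 1]. *)
Lemma fact_le_young l n : 0 < l ->
  n`!%:R <= expR (l * w 1) ^+ n.+1 * expR (scaled_young l n%:R).
Proof.
move=> l0; have w1 : 0 <= w 1 by apply: (weight_ge0 w_weight).
case: n => [|n].
  rewrite expr1 -expRD -[leLHS]expR0 ler_expR -lerBlDl sub0r.
  apply: le_trans (scaled_young_ge l0 (lexx 0) (lexx 0)).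
  by rewrite mul0r sub0r /phi expR0.
have n0 : (0 : R) < n.+1%:R by [].
apply: (@le_trans _ _ (n.+1%:R ^+ n.+1)); first by rewrite -natrX ler_nat leq_fact_expn.
rewrite -{1}[n.+1%:R]lnK ?posrE// -!expRM_natl -expRD ler_expR -lerBlDl.
have t0 : 0 <= ln (n.+1%:R : R) by rewrite ln_ge0// ler1n.
apply: le_trans (scaled_young_ge l0 (ltW n0) t0).
rewrite lerD2l lerN2 /phi lnK ?posrE// mulrCA ler_pM2l//.
apply: (le_trans (weight_natr_le _)) => //.
by rewrite ler_wpM2r// ler_nat.
Qed.

End young_conjugate.

(** * Coefficientwise majorants of polynomials *)

Section majorant.
Variable R : realDomainType.
Implicit Types (p q : {poly R}) (r s : R).

(* The l^1 norm [\sum_i |p_i| r ^+ i], submultiplicative in [p]. *)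
Definition majorant r p := (map_poly Num.norm p).[r].

Lemma coef_norm_poly p i : (map_poly Num.norm p)`_i = `|p`_i|.
Proof. by rewrite coef_map_id0// normr0. Qed.

Lemma majorantC r c : majorant r c%:P = `|c|.
Proof.
rewrite /majorant (_ : map_poly _ _ = `|c|%:P) ?hornerC//.
by apply/polyP => i; rewrite coef_norm_poly !coefC; case: eqP => //; rewrite normr0.
Qed.

Lemma majorantMX r p : majorant r (p * 'X) = majorant r p * r.
Proof.
rewrite /majorant (_ : map_poly _ (_ * 'X) = map_poly Num.norm p * 'X) ?hornerMX//.
apply/polyP => i; rewrite coef_norm_poly !coefMX coef_norm_poly.
by case: eqP => //; rewrite normr0.
Qed.

Lemma majorant_cons r p c : majorant r (p * 'X + c%:P) = majorant r p * r + `|c|.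
Proof.
rewrite -majorantMX -(majorantC r) /majorant -hornerD; congr horner.
apply/polyP => i; rewrite coefD !coef_norm_poly coefD coefMX coefC.
by case: i => [|i] /=; rewrite ?add0r ?addr0 normr0 ?add0r ?addr0.
Qed.

Lemma majorantZ r c p : majorant r (c *: p) = `|c| * majorant r p.
Proof.
rewrite /majorant (_ : map_poly _ _ = `|c| *: map_poly Num.norm p) ?hornerZ//.
by apply/polyP => i; rewrite coef_norm_poly !coefZ coef_norm_poly normrM.
Qed.

Lemma majorantN r p : majorant r (- p) = majorant r p.
Proof. by rewrite -scaleN1r majorantZ normrN1 mul1r. Qed.

Lemma majorant0 r : majorant r 0 = 0.
Proof. by rewrite -(polyC0 R) majorantC normr0. Qed.

Section nonneg.
Variable r : R.
Hypothesis r0 : 0 <= r.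

Lemma majorant_ge0 p : 0 <= majorant r p.
Proof.
elim/poly_ind: p => [|p c IH]; first by rewrite majorant0.
by rewrite majorant_cons addr_ge0// mulr_ge0.
Qed.

Lemma majorantD p q : majorant r (p + q) <= majorant r p + majorant r q.
Proof.
elim/poly_ind: p q => [|p c IH] q; first by rewrite add0r majorant0 add0r.
elim/poly_ind: q => [|q d _]; first by rewrite addr0 majorant0 addr0.
rewrite addrACA -mulrDl -polyCD !majorant_cons addrACA -mulrDl.
by rewrite lerD ?ler_normD// ler_wpM2r.
Qed.

Lemma majorantM p q : majorant r (p * q) <= majorant r p * majorant r q.
Proof.
elim/poly_ind: p => [|p c IH]; first by rewrite mul0r majorant0 mul0r.
rewrite mulrDl mul_polyC majorant_cons mulrDl mulrAC.
apply: (le_trans (majorantD _ _)); rewrite majorantMX majorantZ lerD2r.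
by rewrite mulrAC ler_wpM2r.
Qed.

Lemma majorantX p n : majorant r (p ^+ n) <= majorant r p ^+ n.
Proof.
elim: n => [|n IH]; first by rewrite !expr0 -polyC1 majorantC normr1.
rewrite !exprS; apply: (le_trans (majorantM _ _)).
by rewrite ler_wpM2l// majorant_ge0.
Qed.

Lemma coef_le_majorant p i : `|p`_i| * r ^+ i <= majorant r p.
Proof.
elim/poly_ind: p i => [|p c IH] i; first by rewrite coef0 normr0 mul0r majorant0.
rewrite majorant_cons coefD coefMX coefC; case: i => [|i] /=.
  by rewrite expr0 add0r mulr1 ler_wpDl// mulr_ge0// majorant_ge0.
by rewrite addr0 exprSr mulrA ler_wpDr// ler_wpM2r.
Qed.

Lemma majorant_comp p q : majorant r (p \Po q) <= majorant (majorant r q) p.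
Proof.
elim/poly_ind: p => [|p c IH]; first by rewrite comp_poly0 !majorant0.
rewrite comp_poly_MXaddC majorant_cons -[`|c|](majorantC r).
apply: (le_trans (majorantD _ _)); rewrite lerD2r.
by apply: (le_trans (majorantM _ _)); rewrite ler_wpM2r// majorant_ge0.
Qed.

End nonneg.

Lemma majorant_homo r s p : 0 <= r -> r <= s -> majorant r p <= majorant s p.
Proof.
move=> r0 rs; elim/poly_ind: p => [|p c IH]; first by rewrite !majorant0.
by rewrite !majorant_cons lerD2r ler_pM// majorant_ge0.
Qed.

(** Without constant term, every monomial contains a factor [d], and its further powers are at most
    1. *)
Lemma majorant_dilate d s p : p`_0 = 0 -> 0 <= s -> 0 <= d -> d <= 1 ->
  majorant (d * s) p <= d * majorant s p.
Proof.
elim/poly_ind: p => [|p c _]; first by rewrite !majorant0 mulr0.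
rewrite coefD coefMX coefC /= add0r => -> s0 d0 d1.
rewrite !majorant_cons normr0 !addr0 [leRHS]mulrCA.
rewrite ler_wpM2r ?mulr_ge0// majorant_homo ?mulr_ge0//.
by rewrite ler_piMl.
Qed.

Lemma majorant_scale r s p : 0 <= r -> 1 <= s ->
  majorant (r * s) p <= majorant r p * s ^+ (size p).-1.
Proof.
move=> r0 s1; have s0 : 0 <= s by apply: le_trans s1.
elim/poly_ind: p => [|p c IH]; first by rewrite !majorant0 mul0r.
have [->|p0] := eqVneq p 0; first by rewrite mul0r add0r !majorantC ler_peMr// exprn_ege1.
rewrite size_MXaddC (negbTE p0) /= !majorant_cons mulrDl lerD//; last first.
  by rewrite ler_peMr// exprn_ege1.
rewrite -(prednK (_ : 0 < size p)%N) ?size_poly_gt0// exprSr mulrACA.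
by rewrite ler_wpM2r ?mulr_ge0.
Qed.

End majorant.

(** * Growth of a polynomial and Taylor coefficients of its iterates *)

Section growth.
Variable R : realFieldType.
Implicit Types (p : {poly R}) (x y : R).

Lemma horner_ge_lead p : p != 0 ->
  exists2 c, 0 < c & exists2 T, 1 <= T &
    forall y, T <= `|y| -> c * `|y| ^+ (size p).-1 <= `|p.[y]|.
Proof.
elim/poly_ind: p => [|p c IH]; first by rewrite eqxx.
have [-> c0|p0 _] := eqVneq p 0.
  exists `|c|; last exists 1 => // y _.
    by rewrite normr_gt0; apply: contraNneq c0 => ->; rewrite mul0r add0r.
  by rewrite mul0r add0r hornerC size_polyC; case: eqP => _ /=; rewrite expr0 mulr1.
have [e e0 [T T1 pT]] := IH p0.
exists (e / 2); first by rewrite divr_gt0.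
exists (Num.max T (2 * `|c| / e)); first by rewrite le_max T1.
move=> y; rewrite ge_max => /andP[Ty cy].
rewrite size_MXaddC (negbTE p0) /= hornerMXaddC.
apply: (le_trans _ (lerB_normD _ _)); rewrite normrM.
have y1 : 1 <= `|y| by apply: le_trans Ty.
have sp : (0 < size p)%N by rewrite size_poly_gt0.
have pz := pT _ Ty; rewrite -(prednK sp) exprSr.
move: pz; set z := `|y| ^+ _ => pz.
have z1 : 1 <= z by rewrite exprn_ege1.
have {}cy : 2 * `|c| <= e * `|y| by rewrite [e * _]mulrC -ler_pdivrMr.
have h1 : e * z * `|y| <= `|p.[y]| * `|y| by rewrite ler_wpM2r.
have h2 : e * `|y| <= e * `|y| * z by rewrite ler_peMr// mulr_ge0// ltW.
rewrite lerBrDr; apply: le_trans h1.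
have -> : e / 2 * (z * `|y|) = e * `|y| * z / 2 by ring.
have -> : e * z * `|y| = e * `|y| * z by ring.
move: h2 cy; lra.
Qed.

Lemma horner_coercive p : p != 0 ->
  exists2 C, 1 <= C &
    forall y, (1 + `|y|) ^+ (size p).-1 <= C * (1 + `|p.[y]|).
Proof.
move=> /horner_ge_lead[e e0 [T T1 pT]]; set d := (size p).-1 in pT *.
exists (Num.max ((1 + T) ^+ d) (2 ^+ d / e)).
  by rewrite le_max exprn_ege1// lerDl (le_trans _ T1).
move=> y; have [Ty|/ltW yT] := leP T `|y|.
  apply: (@le_trans _ _ (2 ^+ d / e * (1 + `|p.[y]|))); last first.
    by rewrite ler_wpM2r ?addr_ge0// le_max lexx orbT.
  apply: (@le_trans _ _ (2 ^+ d / e * (e * `|y| ^+ d))); last first.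
    rewrite ler_wpM2l ?divr_ge0 ?exprn_ge0 ?(ltW e0)//.
    by apply: (le_trans (pT _ Ty)); rewrite lerDr.
  rewrite mulrA divfK ?gt_eqF// -exprMn lerXn2r ?nnegrE ?addr_ge0 ?mulr_ge0//.
  by rewrite mulr_natl mulr2n lerD2r (le_trans T1).
apply: (@le_trans _ _ ((1 + T) ^+ d * 1)).
  by rewrite mulr1 lerXn2r ?nnegrE ?addr_ge0 ?lerD2l// (le_trans _ T1).
have T0 : 0 <= (1 + T) ^+ d by rewrite exprn_ge0// addr_ge0// (le_trans _ T1).
apply: ler_pM => //; first by rewrite le_max lexx.
by rewrite lerDl.
Qed.

(** The degree is at least 2, so coercivity gives [|y| ^+ 2 <= C * (1 + |p.[y]|)]. Once [|y|]
    exceeds [C * (L + 1)], this yields [(L + 1) * |y| <= 1 + |p.[y]|], and [|y| >= 1] absorbs the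
    summand 1. *)
Lemma horner_expanding p (L : R) : (2 < size p)%N -> 1 <= L ->
  exists2 T, 1 <= T & forall y, T <= `|y| -> L * `|y| <= `|p.[y]|.
Proof.
move=> p2 L1; have p0 : p != 0 by rewrite -size_poly_gt0; apply: ltn_trans p2.
have [C C1 pC] := horner_coercive p0; have C0 : 0 < C by apply: lt_le_trans C1.
exists (C * (L + 1)) => [|y Ty].
  by rewrite mulr_ege1// lerDr (le_trans _ L1).
have y1 : 1 <= `|y| by apply: le_trans Ty; rewrite mulr_ege1// lerDr (le_trans _ L1).
have {}pC : `|y| ^+ 2 <= C * (1 + `|p.[y]|).
  apply: le_trans (pC y); apply: (@le_trans _ _ ((1 + `|y|) ^+ 2)).
    by rewrite lerXn2r ?nnegrE ?addr_ge0// lerDr.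
  by rewrite ler_weXn2l ?lerDl// -ltnS prednK// ltnW// ltnW.
have : C * (L + 1) * `|y| <= C * (1 + `|p.[y]|).
  by apply: le_trans pC; rewrite expr2 ler_wpM2r.
rewrite -mulrA ler_pM2l// mulrDl mul1r; lra.
Qed.

(* Since [psi_(m+1)(x + .) - psi_(m+1)(x)] is the composition of the shift of
   [psi] at [psi_m(x)] with [psi_m(x + .) - psi_m(x)], iterating this bound loses
   only a factor [K] at each step as long as the relative size [d] is at most 1. *)
Lemma majorant_shift_le p : p != 0 ->
  exists2 K, 1 <= K & forall d y, 0 <= d -> d <= 1 ->
    majorant (d * (1 + `|y|)) (p \Po ('X + y%:P) - (p.[y])%:P)
      <= K * d * (1 + `|p.[y]|).
Proof.
move=> p0; have [C C1 pC] := horner_coercive p0.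
have C0 : 0 <= C by apply: le_trans C1.
exists (majorant 2 p * C + 1) => [|d y d0 d1].
  by rewrite lerDr mulr_ge0// majorant_ge0.
have y0 : 0 <= 1 + `|y| by rewrite addr_ge0.
apply: (le_trans (majorant_dilate _ y0 d0 d1)).
  by rewrite coefB coefC /= -horner_coef0 horner_comp hornerD hornerX hornerC add0r subrr.
rewrite mulrAC [_ * d]mulrC ler_wpM2l//.
apply: (le_trans (majorantD y0 _ _)); rewrite majorantN majorantC mulrDl mul1r.
apply: lerD; last by rewrite lerDr.
apply: (le_trans (majorant_comp y0 _ _)).
(* The shift by [y] at most doubles the radius [1 + |y|]; the growth of [p] then costs a power
   [(1 + |y|) ^+ deg p], which coercivity turns back into [1 + |p.[y]|]. *)
have h : majorant (1 + `|y|) ('X + y%:P) <= 2 * (1 + `|y|).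
  rewrite -['X]mul1r -polyC1 majorant_cons majorantC normr1 mul1r; move: y0; lra.
apply: (le_trans (majorant_homo _ (majorant_ge0 y0 _) h)).
have y1 : 1 <= 1 + `|y| by rewrite lerDl.
apply: (le_trans (majorant_scale p (ler0n _ 2) y1)).
by rewrite -mulrA ler_wpM2l ?majorant_ge0.
Qed.

(** With initial radius [K ^- m], the relative size after [j] steps is at most
    [K ^+ j / K ^+ m <= 1], so the one-step bound stays applicable until the factors [K] are used up
    exactly at [j = m]. *)
Lemma majorant_iter_le p : p != 0 ->
  exists2 K, 1 <= K & forall m x,
    majorant (K ^- m) (iter m (fun q => p \Po q) 'X \Po ('X + x%:P)
                       - (iter m (horner p) x)%:P)
      <= 1 + `|iter m (horner p) x|.
Proof.
move=> p0; have [K K1 pK] := majorant_shift_le p0; exists K => // m x.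
have K0 : 0 < K by apply: lt_le_trans K1.
set it := fun j => iter j (fun q => p \Po q) 'X; set y := fun j => iter j (horner p) x.
have itE j : (it j).[x] = y j.
  by elim: j => [|j IH]; rewrite /it /y /= ?hornerX// horner_comp -/(it j) IH.
suff main j : (j <= m)%N ->
    majorant (K ^- m) (it j \Po ('X + x%:P) - (y j)%:P) <= K ^+ j / K ^+ m * (1 + `|y j|).
  by have := main m (leqnn m); rewrite divff ?mul1r// gt_eqF// exprn_gt0.
have r0 : 0 <= K ^- m by rewrite invr_ge0 exprn_ge0// ltW.
elim: j => [_|j IH jm].
  rewrite /it /y /= comp_polyX addrK expr0 mul1r.
  rewrite -['X]addr0 -[X in X + _]mul1r -polyC1 -(polyC0 R) majorant_cons.
  by rewrite majorantC normr0 normr1 mul1r addr0 ler_peMr// lerDl.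
have -> : it j.+1 \Po ('X + x%:P) - (y j.+1)%:P =
    (p \Po ('X + (y j)%:P) - (p.[y j])%:P) \Po (it j \Po ('X + x%:P) - (y j)%:P).
  rewrite comp_polyB comp_polyC; congr (_ - _).
  by rewrite -[RHS]comp_polyA comp_polyD comp_polyX comp_polyC subrK comp_polyA.
apply: (le_trans (majorant_comp r0 _ _)).
have h0 : 0 <= K ^+ j / K ^+ m by rewrite mulr_ge0// exprn_ge0// ltW.
have h1 : K ^+ j / K ^+ m <= 1.
  by rewrite ler_pdivrMr ?exprn_gt0// mul1r ler_weXn2l// ltnW.
apply: (le_trans (majorant_homo _ (majorant_ge0 r0 _) (IH (ltnW jm)))).
by rewrite exprS -[K * _ / _]mulrA; exact: pK.
Qed.

End growth.

(** * Orbits of polynomials on the line *)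

Section iterates.
Variables (R : realType) (p : {poly R}).
Hypothesis p_deg : (2 < size p)%N.
Implicit Types (x y : R).

Local Notation it m := (iter m (horner p)).

Lemma iter_expanding (L T : R) : 1 <= L -> 1 <= T ->
    (forall y, T <= `|y| -> L * `|y| <= `|p.[y]|) ->
  forall m x, T <= `|x| -> L ^+ m * `|x| <= `|it m x|.
Proof.
move=> L1 T1 pT m x Tx; have L0 : 0 <= L by apply: le_trans L1.
elim: m => [|m IH]; first by rewrite expr0 mul1r.
have h : T <= `|it m x|.
  by apply: le_trans Tx (le_trans _ IH); rewrite ler_peMl// exprn_ege1.
by rewrite iterS exprS -mulrA; apply: le_trans (pT _ h); rewrite ler_wpM2l.
Qed.

Hypothesis p_nofix : ~ exists x, p.[x] = x.

(** Without fixed points, [p - 'X] has constant sign by the intermediate value theorem; [s] is that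
    sign, read off at 0, and [d] is a minimum over the compact interval. *)
Lemma displacement_bounded_below (T : R) : 1 <= T ->
  exists2 s, `|s| = 1 & exists2 d, 0 < d &
    forall x, `|x| <= T -> d <= s * (p.[x] - x).
Proof.
move=> T1.
pose s : R := if 0 < p.[0] then 1 else -1.
exists s; first by rewrite /s; case: ifP; rewrite ?normrN normr1.
pose r := s *: (p - 'X).
have rE x : r.[x] = s * (p.[x] - x) by rewrite /r hornerZ hornerD hornerN hornerX.
have s0 : s != 0 by rewrite /s; case: ifP; rewrite ?oppr_eq0 oner_eq0.
have r0 x : r.[x] != 0.
  rewrite rE mulf_neq0// subr_eq0; apply/eqP => px; apply: p_nofix.
  by exists x.
have r00 : 0 < r.[0].
  rewrite lt_neqAle eq_sym r0 rE subr0 /s; case: ltP => [p0|p0] /=.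
    by rewrite mul1r ltW.
  by rewrite mulN1r oppr_ge0.
have rc : continuous (horner r) by exact: continuous_horner.
have rpos x : 0 < r.[x].
  rewrite ltNge; apply/negP => rx.
  have [x0|x0] := leP 0 x.
    have [|c _ /eqP] := @IVT R (horner r) 0 x 0 x0 (continuous_subspaceT rc).
      by rewrite ge_min le_max rx (ltW r00) orbT.
    by apply/negP; exact: r0.
  have [|c _ /eqP] := @IVT R (horner r) x 0 0 (ltW x0) (continuous_subspaceT rc).
    by rewrite ge_min le_max rx (ltW r00) orbT.
  by apply/negP; exact: r0.
have TT : - T <= T by rewrite ge0_cp// (le_trans _ T1).
have [c _ cmin] := EVT_min TT (continuous_subspaceT rc).
exists r.[c] => // x; rewrite ler_norml => xT.
by rewrite -rE; apply: cmin; rewrite in_itv.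
Qed.

(** While it stays in [[-T, T]], an orbit moves by at least [d] at each step, always in the
    direction [s]. More than [2 * T / d] such steps would exceed the length of the interval,
    whatever the starting point. *)
Lemma orbit_escapes (T : R) : 1 <= T ->
  exists n, forall x, exists2 j, (j <= n)%N & T <= `|it j x|.
Proof.
move=> T1; have [s s1 [d d0 dp]] := displacement_bounded_below T1.
exists (Num.truncn (2 * T / d)).+1 => x; set n := (Num.truncn _).+1.
apply: contrapT => hno.
have small j : (j <= n)%N -> `|it j x| <= T.
  by move=> jn; rewrite leNgt; apply/negP => /ltW Tj; apply: hno; exists j.
have far j : (j <= n)%N -> d * j%:R <= s * (it j x - x).
  elim: j => [|j IH] jn; first by rewrite mulr0 subrr mulr0.
  have := dp _ (small _ (ltnW jn)); have := IH (ltnW jn).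
  rewrite iterS -natr1 !mulrBr mulrDr mulr1; lra.
have := far _ (leqnn n); apply/negP; rewrite -ltNge.
apply: (@le_lt_trans _ _ (2 * T)).
  apply: (le_trans (ler_norm _)); rewrite normrM s1 mul1r.
  apply: (le_trans (ler_normB _ _)).
  by rewrite mulr_natl mulr2n lerD// (small _ (leqnn n), small 0).
by rewrite -ltr_pdivrMl// mulrC /n truncnS_gt.
Qed.

Lemma orbit_growth (L : R) : 1 <= L ->
  exists2 C, 1 <= C & forall m x,
    L ^+ m <= C * (1 + `|it m x|) /\ 1 + `|x| <= C * (1 + `|it m x|).
Proof.
move=> L1; have L0 : 0 < L by apply: lt_le_trans L1.
have [T T1 pT] := horner_expanding p_deg L1.
have [n nP] := orbit_escapes T1.
have Ln1 : 1 <= L ^+ n by rewrite exprn_ege1.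
have T0 : 0 <= T by apply: le_trans T1.
(* [L ^+ n] pays for the at most [n] steps before the orbit reaches the expanding region; [1 + T]
   bounds [1 + |x|] when [x] starts outside that region. *)
exists (L ^+ n + (1 + T)) => [|m x]; first by rewrite ler_wpDr// addr_ge0.
have C0 : 0 <= L ^+ n by apply: le_trans Ln1.
have y0 : 0 <= `|it m x| by [].
have y1 : 1 <= 1 + `|it m x| by rewrite lerDl.
split.
  apply: (@le_trans _ _ (L ^+ n * (1 + `|it m x|))); last first.
    by rewrite ler_wpM2r// ?addr_ge0// lerDl addr_ge0.
  have [mn|nm] := leqP m n.
    by apply: (@le_trans _ _ (L ^+ n)); [rewrite ler_weXn2l|rewrite ler_peMr].
  have [j jn Tj] := nP x.
  have jm : (j <= m)%N by apply: leq_trans jn (ltnW nm).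
  have := iter_expanding L1 T1 pT (m - j)%N Tj; rewrite -iterD subnK// => h.
  rewrite -(subnKC jm) exprD ler_pM ?exprn_ge0 ?(ltW L0)// ?ler_weXn2l//.
  apply: (@le_trans _ _ (L ^+ (m - j) * `|it j x|)).
    by rewrite ler_peMr ?exprn_ge0 ?(ltW L0)// (le_trans T1).
  by apply: (le_trans h); rewrite subnKC// lerDr.
have [Tx|xT] := leP T `|x|.
  have := iter_expanding L1 T1 pT m Tx => h.
  have {}h : `|x| <= `|it m x| by apply: le_trans h; rewrite ler_peMl// exprn_ege1.
  apply: (@le_trans _ _ (1 + `|it m x|)); first by rewrite lerD2l.
  by rewrite ler_peMl ?addr_ge0// ler_wpDr// addr_ge0.
apply: (@le_trans _ _ (1 + T)); first by rewrite lerD2l ltW.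
apply: (@le_trans _ _ (L ^+ n + (1 + T))); first by rewrite lerDr.
by rewrite ler_peMr// addr_ge0// addr_ge0.
Qed.

End iterates.

(** * A fixed point is incompatible with an equi-Lipschitz family *)

Section fixed_point.
Variables (R : realType) (p : {poly R}).
Hypothesis p_deg : (2 < size p)%N.

Lemma fixed_point_not_equi_lipschitz (f : R -> R) (C x0 : R) :
    (forall x, 0 < f x) -> (forall x y, `|x| <= `|y| -> f y <= f x) ->
    (forall e, 0 < e -> exists T, forall x, T <= `|x| -> f x <= e) ->
    0 < C ->
    (forall m x y, `|f (iter m.+1 (horner p) x) - f (iter m.+1 (horner p) y)| <= C * `|x - y|) ->
  p.[x0] != x0.
Proof.
move=> f0 fdec flim C0 fC; apply/eqP => px0.
have L1 : (1 : R) <= 2 by rewrite ler1n.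
have [T T1 pT] := horner_expanding p_deg L1.
have expand := iter_expanding L1 T1 pT.
have T0 : 0 <= T by apply: le_trans T1.
(* An orbit that once leaves [[-T, T]] is expanded forever, so a bounded orbit lies entirely in this
   interval. *)
pose bounded x := forall m, `|iter m (horner p) x| <= T.
(* Along a bounded orbit [f] stays above [f T], along an escaping one it falls below [f T / 2]; at
   distance [d] the Lipschitz bound allows a gap of only [f T / 4]. *)
pose d := f T / (4 * C).
have d0 : 0 < d by rewrite divr_gt0// mulr_gt0.
have step x y : bounded x -> `|x - y| <= d -> bounded y.
  move=> bx xy m; rewrite leNgt; apply/negP => /ltW Tm.
  have [|T' fT'] := flim (f T / 2); first by rewrite divr_gt0.
  pose j := (Num.truncn T').+1.
  have jT : T' <= `|iter (j + m) (horner p) y|.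
    rewrite iterD; apply: le_trans (expand j _ Tm).
    apply: (@le_trans _ _ (2 ^+ j)); last by rewrite ler_peMr ?exprn_ge0// (le_trans T1).
    apply: (@le_trans _ _ j%:R); first by rewrite ltW// truncnS_gt.
    by rewrite -natrX ler_nat ltnW// ltn_expl.
  have fx : f T <= f (iter (j + m) (horner p) x).
    by apply: fdec; rewrite [leRHS]ger0_norm// bx.
  have := fC (Num.truncn T' + m)%N x y; rewrite -addSn -/j.
  have := fT' _ jT => fy.
  have h : C * `|x - y| <= f T / 4.
    apply: (@le_trans _ _ (C * d)); first by rewrite ler_wpM2l// ltW.
    by rewrite /d invfM mulrCA [C * _]mulrC mulfVK ?gt_eqF.
  move=> /(le_trans (ler_norm _)) /le_trans /(_ h).
  have := f0 T; move: fx fy; lra.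
(* Walk away from the fixed point by steps of length [d]. For [k = 0], expansion at [x0] would give
   [2 * |x0| <= |x0|]. *)
have b0 k : bounded (x0 + d * k%:R).
  elim: k => [|k IH].
    move=> m; rewrite mulr0 addr0 (_ : iter m _ _ = x0).
      rewrite leNgt; apply/negP => /ltW Tx; have := expand 1%N _ Tx.
      rewrite expr1 /= px0; apply/negP; rewrite -ltNge.
      have : 1 <= `|x0| by apply: le_trans Tx.
      by lra.
    by elim: m => //= m ->.
  apply: step IH _; rewrite -natr1 mulrDr mulr1 addrA opprD addrA subrr add0r normrN.
  by rewrite gtr0_norm.
pose k := (Num.truncn ((T + `|x0|) / d)).+1.
have := b0 k 0%N => /=.
have hk : T + `|x0| < d * k%:R by rewrite -ltr_pdivrMl// mulrC truncnS_gt.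
have := ler_norm (x0 + d * k%:R); have := ler_norm (- x0); rewrite normrN.
move: hk; lra.
Qed.

End fixed_point.

(** * Derivatives of a composition with a polynomial *)

Section composition.
Variable R : realType.
Implicit Types (u : R -> R) (g p : {poly R}) (x y : R).

Lemma derive1n_horner p n : derive1n n (horner p) = horner (derivn n p).
Proof. by elim: n => [//|n IH]; rewrite derive1nS IH derivnS derivE. Qed.

Lemma rsmooth_horner p : rsmooth (horner p).
Proof. by move=> n x; rewrite derive1n_horner; exact: derivable_horner. Qed.

Lemma rsmooth_is_derive u n x : rsmooth u ->
  is_derive x (1 : R) (derive1n n u) (derive1n n.+1 u x).
Proof. by move=> su; rewrite derive1nS derive1E; apply: DeriveDef => //; exact: su. Qed.

(* The [P k] are the Bell polynomials of [g] in Faa di Bruno's formula; only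
   their independence of [u] matters, since it allows to compute them by taking
   for [u] the monomials. *)
Lemma derive1n_comp_horner g n : exists P : nat -> {poly R},
  forall u, rsmooth u ->
    derive1n n (u \o horner g) =
    fun x => \sum_(k < n.+1) derive1n k u g.[x] * (P k).[x].
Proof.
elim: n => [|n [P IH]].
  exists (fun=> 1) => u _; apply/funext => x.
  by rewrite big_ord_recl big_ord0 addr0 hornerC mulr1.
(* Differentiating the [k]-th term yields one term with [f^(k)] and [deriv (P k)], and one with
   [f^(k+1)] and [P k * deriv g]. The test [k <= n] discards [P n.+1], about which the induction
   hypothesis says nothing. *)
pose Q k := if k is j.+1 then P j * deriv g else 0 : {poly R}.
exists (fun k => (if (k <= n)%N then deriv (P k) else 0) + Q k) => u su.
apply/funext => x; rewrite derive1nS IH// derive1E.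
have dk (k : 'I_n.+1) : is_derive x (1 : R)
    (fun x => derive1n k u g.[x] * (P k).[x])
    (derive1n k u g.[x] * (deriv (P k)).[x] +
     derive1n k.+1 u g.[x] * (P k * deriv g).[x]).
  have d1 : is_derive x (1 : R) (derive1n k u \o horner g)
      (derive1n k.+1 u g.[x] * (deriv g).[x]).
    exact: is_derive1_comp (rsmooth_is_derive _ _ su) (is_derive_poly _ _).
  have := is_deriveM d1 (is_derive_poly (P k) x).
  move=> /is_derive_eq; apply; rewrite hornerM /=.
  rewrite -![_ *: _]/(_ * _); ring.
have := is_derive_sum dk; rewrite fct_sumE => dsum; rewrite (@derive_val _ _ _ _ _ _ _ dsum).
rewrite big_split /=; under [RHS]eq_bigr do rewrite hornerD mulrDr.
rewrite [RHS]big_split /=; congr (_ + _).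
  rewrite [RHS]big_ord_recr /= ltnn horner0 mulr0 addr0.
  by apply: eq_bigr => k _; rewrite -ltnS ltn_ord.
by rewrite [RHS]big_ord_recl /= horner0 mulr0 add0r.
Qed.

Lemma derivn_eval_comp p n x :
  (derivn n p).[x] = (p \Po ('X + x%:P))`_n *+ n`!.
Proof.
have d k : derivn k (p \Po ('X + x%:P)) = derivn k p \Po ('X + x%:P).
  elim: k => // k IH; rewrite !derivnS IH deriv_comp derivD derivX derivC addr0.
  by rewrite mulr1.
have := coef_derivn n (p \Po ('X + x%:P)) 0.
rewrite addn0 ffactnn => <-.
by rewrite d -horner_coef0 horner_comp hornerD hornerX hornerC add0r.
Qed.

(** Taking [('X - y) ^+ k] for [u] isolates [P k]: at [y = g.[x]] its derivatives all vanish except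
    the [k]-th, which is [k!]. *)
Lemma derive1n_comp_horner_taylor g n u x : rsmooth u ->
  derive1n n (u \o horner g) x =
  \sum_(k < n.+1) derive1n k u g.[x] *
    (n`!%:R / k`!%:R * ((g \Po ('X + x%:P) - (g.[x])%:P) ^+ k)`_n).
Proof.
move=> su; have [P Pu] := derive1n_comp_horner g n; rewrite Pu//.
apply: eq_bigr => k _; congr (_ * _).
set y := g.[x].
have XnE i : (('X - y%:P) ^+ k \Po ('X + y%:P))`_i = (i == k)%:R.
  by rewrite rmorphXn /= comp_polyB comp_polyX comp_polyC addrK coefXn.
have := congr1 (fun f => f x) (Pu _ (@rsmooth_horner (('X - y%:P) ^+ k))).
rewrite /= (bigD1 k)//= big1 ?addr0 => [|i ik]; last first.
  move: ik; rewrite derive1n_horner derivn_eval_comp XnE -val_eqE => /negbTE -> /=.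
  by rewrite mul0rn mul0r.
rewrite derive1n_horner derivn_eval_comp XnE eqxx.
have -> : horner (('X - y%:P) ^+ k) \o horner g = horner ((g - y%:P) ^+ k).
  by apply/funext => z; rewrite /= !horner_exp !hornerD !hornerN !hornerC hornerX.
rewrite derive1n_horner derivn_eval_comp rmorphXn /= comp_polyB comp_polyC => h.
have k0 : k`!%:R != 0 :> R by rewrite pnatr_eq0 -lt0n fact_gt0.
by rewrite mulrAC mulr_natl h mulrAC divff ?mul1r.
Qed.

Lemma coef_exp_le_majorant p n k r : 0 < r ->
  `|(p ^+ k)`_n| <= majorant r p ^+ k * r ^- n.
Proof.
move=> r0; rewrite ler_pdivlMr ?exprn_gt0//.
by apply: le_trans (majorantX (ltW r0) p k); apply: coef_le_majorant; exact: ltW.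
Qed.

Lemma cabs_sum (I : Type) (s : seq I) (P : pred I) (u v c : I -> R) :
  cabs (Complex (\sum_(i <- s | P i) u i * c i) (\sum_(i <- s | P i) v i * c i))
    <= \sum_(i <- s | P i) cabs (Complex (u i) (v i)) * `|c i|.
Proof.
elim/big_rec3: _ => [|i z a b Pi IH]; first by rewrite Normc.normc0.
have -> : Complex (u i * c i + b) (v i * c i + a) =
  Complex (u i) (v i) * Complex (c i) 0 + Complex b a.
  by apply/eqP; rewrite eq_complex /=; rewrite !mulr0 subr0 add0r !eqxx.
apply: (le_trans (le_normcD _ _)); rewrite Normc.normcM.
rewrite {2}/cabs; rewrite /= expr0n addr0 sqrtr_sqr; exact: lerD.
Qed.

Lemma cderiv_comp_horner_le (f : R -> R[i]) g n r x :
    csmooth f -> 0 < r ->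
  cabs (cderiv n (f \o horner g) x) <=
  \sum_(k < n.+1) cabs (cderiv k f g.[x]) *
    (n`!%:R / k`!%:R * majorant r (g \Po ('X + x%:P) - (g.[x])%:P) ^+ k * r ^- n).
Proof.
move=> /asboolP[sr si] r0; rewrite /cderiv.
have compE (h : R[i] -> R) :
  h \o (f \o horner g) = (h \o f) \o horner g :> (R -> R) by [].
rewrite !compE !derive1n_comp_horner_taylor//.
apply: (le_trans (cabs_sum _ _ _ _ _)); apply: ler_sum => k _.
rewrite ler_wpM2l//; first by rewrite /cabs sqrtr_ge0.
by rewrite normrM ger0_norm ?divr_ge0// -mulrA ler_wpM2l ?divr_ge0// coef_exp_le_majorant.
Qed.

Lemma csmooth_comp_horner (f : R -> R[i]) g :
  csmooth f -> csmooth (f \o horner g).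
Proof.
have comp u : rsmooth u -> rsmooth (u \o horner g).
  move=> su n x; have [P Pu] := derive1n_comp_horner g n; rewrite Pu//.
  rewrite -fct_sumE; apply: derivable_sum => k.
  apply: derivableM; last exact: derivable_horner.
  have d1 := is_derive1_comp (rsmooth_is_derive k g.[x] su) (is_derive_poly g x).
  exact: (@ex_derive _ _ _ _ _ _ _ d1).
by move=> /asboolP[sr si]; apply/asboolP; split; [exact: (comp _ sr)|exact: (comp _ si)].
Qed.

End composition.

(** * The Gaussian belongs to every Gelfand-Shilov space *)

Section gaussian.
Variable R : realType.
Implicit Types (x y : R).

Definition gaussian x : R := expR (- (x ^+ 2 / 2)).

Lemma gaussian_gt0 x : 0 < gaussian x. Proof. exact: expR_gt0. Qed.

Lemma gaussian_nonincreasing_norm x y : `|x| <= `|y| -> gaussian y <= gaussian x.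
Proof.
move=> xy; rewrite ler_expR lerN2 ler_pM2r ?invr_gt0//.
by rewrite -[x ^+ 2]real_normK ?num_real// -[y ^+ 2]real_normK ?num_real// lerXn2r ?nnegrE.
Qed.

Lemma gaussian_vanishes (e : R) : 0 < e ->
  exists T : R, forall x, T <= `|x| -> gaussian x <= e.
Proof.
move=> e0; exists (Num.max 2 e^-1) => x; rewrite ge_max => /andP[x2 xe].
rewrite /gaussian expRN -[leRHS]invrK lef_pV2 ?posrE ?invr_gt0 ?expR_gt0//.
apply: (le_trans xe); apply: le_trans (expR_ge1Dx _).
rewrite -[x ^+ 2]real_normK ?num_real//; move: x2; set z := `|x| => x2.
have : 2 * z <= z ^+ 2 by rewrite expr2 ler_wpM2r ?normr_ge0.
lra.
Qed.

Lemma is_derive_gaussian x : is_derive x (1 : R) gaussian (- x * gaussian x).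
Proof.
have h : is_derive x (1 : R) (horner (- ('X ^+ 2 * (2^-1)%:P))) (- x).
  apply: is_derive_eq.
  rewrite derivN derivM derivXn derivC mulr0 addr0 expr1 !hornerE /=.
  by field.
have -> : gaussian = expR \o horner (- ('X ^+ 2 * (2^-1)%:P)).
  by apply/funext => y; rewrite /gaussian /= !hornerE.
have := is_derive1_comp (is_derive_expR _) h.
by move=> /is_derive_eq; apply; rewrite mulrC.
Qed.

Lemma derive1n_gaussian_horner n : exists p : {poly R},
  derive1n n gaussian = fun x => p.[x] * gaussian x.
Proof.
elim: n => [|n [p IH]].
  by exists 1; apply/funext => x; rewrite hornerC mul1r.
exists (deriv p - p * 'X); apply/funext => x; rewrite derive1nS IH derive1E.
have d := is_deriveM (is_derive_poly p x) (is_derive_gaussian x).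
rewrite (@derive_val _ _ _ _ _ _ _ d) -![_ *: _]/(_ * _).
rewrite hornerD hornerN hornerM hornerX; ring.
Qed.

Lemma rsmooth_gaussian : rsmooth gaussian.
Proof.
move=> n x; have [p ->] := derive1n_gaussian_horner n.
exact: (@ex_derive _ _ _ _ _ _ _ (is_deriveM (is_derive_poly p x) (is_derive_gaussian x))).
Qed.

(** The Hermite recurrence, from repeated differentiation of [G' = - x G]. *)
Lemma derive1n_gaussianSS n x : derive1n n.+2 gaussian x =
  - x * derive1n n.+1 gaussian x - n.+1%:R * derive1n n gaussian x.
Proof.
have D k y := rsmooth_is_derive k y rsmooth_gaussian.
have D1 : derive1n 1 gaussian = fun y => - y * gaussian y.
  by apply/funext => y; rewrite /= derive1E (@derive_val _ _ _ _ _ _ _ (is_derive_gaussian y)).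
have NE y : (- id) y = - y :> R by [].
elim: n x => [|n IH] x.
  have d := is_deriveM (is_deriveN (is_derive_id x (1 : R))) (is_derive_gaussian x).
  rewrite derive1nS D1 derive1E (@derive_val _ _ _ _ _ _ _ d).
  by rewrite -![_ *: _]/(_ * _) NE /=; ring.
rewrite derive1nS [in LHS](funext IH) derive1E.
have d := is_deriveB (is_deriveM (is_deriveN (is_derive_id x (1 : R))) (D n.+1 x))
                     (is_deriveZ n.+1%:R (D n x)).
rewrite (@derive_val _ _ _ _ _ _ _ d) -![_ *: _]/(_ * _) -[n.+2%:R]natr1 NE.
ring.
Qed.

(* With [u = |x| + sqrt n], one has [|x| u + n <= u ^+ 2], which propagates the
   bound along the Hermite recurrence. *)
Lemma derive1n_gaussian_le n x :
  `|derive1n n gaussian x| <= (`|x| + Num.sqrt n%:R) ^+ n * gaussian x.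
Proof.
(* The recurrence has order two, so two consecutive bounds are carried through the induction. *)
suff [] : `|derive1n n gaussian x| <= (`|x| + Num.sqrt n%:R) ^+ n * gaussian x /\
    `|derive1n n.+1 gaussian x| <= (`|x| + Num.sqrt n.+1%:R) ^+ n.+1 * gaussian x by [].
have g0 := gaussian_gt0 x.
elim: n => [|n [IH1 IH2]].
  rewrite expr0 mul1r ger0_norm ?(ltW g0)//; split => //.
  rewrite /= derive1E (@derive_val _ _ _ _ _ _ _ (is_derive_gaussian x)).
  by rewrite normrM normrN (ger0_norm (ltW g0)) sqrtr1 expr1 ler_wpM2r ?(ltW g0)// lerDl.
split => //; rewrite derive1n_gaussianSS.
set u := `|x| + Num.sqrt n.+1%:R in IH2.
have u0 : 0 <= u by rewrite addr_ge0// sqrtr_ge0.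
have un : `|x| + Num.sqrt n%:R <= u by rewrite lerD2l ler_wsqrtr// ler_nat.
have h1 : `|derive1n n gaussian x| <= u ^+ n * gaussian x.
  apply: (le_trans IH1); rewrite ler_wpM2r ?(ltW g0)//.
  by rewrite lerXn2r ?nnegrE ?addr_ge0 ?sqrtr_ge0.
apply: (@le_trans _ _ (u ^+ n.+2 * gaussian x)); last first.
  rewrite ler_wpM2r ?(ltW g0)// lerXn2r ?nnegrE ?addr_ge0 ?sqrtr_ge0//.
  by rewrite lerD2l ler_wsqrtr// ler_nat.
apply: (le_trans (ler_normB _ _)); rewrite !normrM normrN normr_nat.
apply: (le_trans (lerD (ler_wpM2l (normr_ge0 x) IH2) (ler_wpM2l (ler0n _ n.+1) h1))).
have -> : `|x| * (u ^+ n.+1 * gaussian x) + n.+1%:R * (u ^+ n * gaussian x) =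
  (u * `|x| + n.+1%:R) * u ^+ n * gaussian x by rewrite exprS; ring.
rewrite ler_wpM2r ?(ltW g0)// !exprS mulrA ler_wpM2r ?exprn_ge0//.
have -> : u * u = u * `|x| + u * Num.sqrt n.+1%:R by rewrite -mulrDr.
rewrite lerD2l.
rewrite -{1}[n.+1%:R]sqr_sqrtr// expr2 ler_wpM2r ?sqrtr_ge0//.
by rewrite lerDr.
Qed.

Lemma exp_coeff_le_expR x n : 0 <= x -> x ^+ n <= n`!%:R * expR x.
Proof.
move=> x0; rewrite -ler_pdivrMl ?ltr0n ?fact_gt0// mulrC.
case: n => [|n]; first by rewrite expr0 divr1 -expR0 ler_expR.
by apply: le_trans (expR_ge1Dxn n x0); rewrite lerDr.
Qed.

Definition cgaussian x : R[i] := Complex (gaussian x) 0.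

Lemma derive1n_cst0 n : derive1n n (cst 0) = cst 0 :> (R -> R).
Proof.
by elim: n => // n IH; rewrite derive1nS IH; apply/funext => y; exact: derive1_cst.
Qed.

Lemma cderiv_cgaussian n x :
  cderiv n cgaussian x = Complex (derive1n n gaussian x) 0.
Proof. by congr Complex; rewrite -[RHS](congr1 (fun f => f x) (derive1n_cst0 n)). Qed.

Lemma csmooth_cgaussian : cgaussian \in @csmooth R.
Proof.
apply/asboolP; split; first exact: rsmooth_gaussian.
move=> n x; rewrite (_ : @complex.Im R \o cgaussian = cst 0); last exact/funext.
by rewrite derive1n_cst0; exact: derivable_cst.
Qed.

Lemma cabs_real (c : R) : cabs (Complex c 0) = `|c|.
Proof. by rewrite /= expr0n addr0 sqrtr_sqr. Qed.

Lemma gs_norm_cgaussian_fin (w : R -> R) (l : {posnum R}) :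
  weight w -> weight_subadditive w -> (gs_norm w l cgaussian < +oo)%E.
Proof.
move=> ww wsub; have l0 : 0 < l%:num by [].
set l' := l%:num in l0 *.
(* [t] is chosen so that [t ^+ s] cancels both the factor [A ^+ s] from the bound on [s!] and the
   factor [expR (2^-1) ^+ s] from completing squares. *)
set A := expR (l' * w 1); set t := A * expR (2^-1).
have t0 : 0 < t by rewrite mulr_gt0 ?expR_gt0.
apply: (@le_lt_trans _ _ (A * expR (t + t ^+ 2))%:E); last exact: ltry.
apply: ge_ereal_sup => _ [x [n [q ->]]]; rewrite lee_fin.
rewrite -[l%:num * _]/(scaled_young w l' (n + q)%:R) expRN ler_pdivrMr ?expR_gt0//.
rewrite cderiv_cgaussian cabs_real; set s := (n + q)%N.
set v := 1 + `|x| + Num.sqrt s%:R.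
have v0 : 0 <= v by rewrite !addr_ge0// sqrtr_ge0.
have h1 : (1 + `|x|) ^+ q * `|derive1n n gaussian x| <= v ^+ s * gaussian x.
  rewrite /s addnC exprD -mulrA ler_pM ?exprn_ge0 ?addr_ge0//.
    by rewrite lerXn2r ?nnegrE ?addr_ge0// lerDl sqrtr_ge0.
  apply: (le_trans (derive1n_gaussian_le n x)); rewrite ler_wpM2r ?(ltW (gaussian_gt0 x))//.
  rewrite lerXn2r ?nnegrE ?addr_ge0 ?sqrtr_ge0//.
  by rewrite lerD ?lerDr// ler_wsqrtr// ler_nat leq_addr.
apply: (le_trans h1).
have h2 : t ^+ s * v ^+ s <= s`!%:R * expR (t * v).
  by rewrite -exprMn exp_coeff_le_expR// mulr_ge0// ltW.
(* Both [t * |x|] and [t * sqrt s] are bounded by half the sum of the two squares; the half of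
   [x ^+ 2] is absorbed by the Gaussian. *)
have h3 : expR (t * v) * gaussian x <= expR (t + t ^+ 2) * expR (2^-1) ^+ s.
  rewrite -expRM_natl -!expRD ler_expR /v.
  have : 0 <= (`|x| - t) ^+ 2 by exact: sqr_ge0.
  have : 0 <= (Num.sqrt s%:R - t) ^+ 2 by exact: sqr_ge0.
  have : Num.sqrt s%:R ^+ 2 = s%:R :> R by rewrite sqr_sqrtr.
  rewrite -[x ^+ 2]real_normK ?num_real//.
  move: (Num.sqrt _) `|x| => a b; rewrite !sqrrB; lra.
have ts0 : 0 < t ^+ s by rewrite exprn_gt0.
rewrite -(ler_pM2l ts0) mulrA.
apply: (le_trans (ler_wpM2r (ltW (gaussian_gt0 x)) h2)).
rewrite -mulrA; apply: (le_trans (ler_wpM2l (ler0n _ _) h3)).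
have h4 := fact_le_young ww wsub s l0; rewrite -/A in h4.
apply: (le_trans (ler_wpM2r _ h4)); first by rewrite mulr_ge0 ?exprn_ge0 ?expR_ge0.
rewrite [t ^+ s]exprMn exprS; set E := expR (t + _).
by rewrite le_eqVlt; apply/orP; left; apply/eqP; ring.
Qed.

End gaussian.

(** * Equicontinuity of composition operators *)

Section operators.
Variables (R : realType) (X Y : seminorms (smoothfun R)).

Lemma lcvalB (Z : seminorms (smoothfun R)) (F G : lcspace Z) :
  lcval (F - G) = lcval F - lcval G.
Proof. by []. Qed.

Lemma lcvalZ (Z : seminorms (smoothfun R)) (c : R[i]) (F : lcspace Z) :
  lcval (c *: F) = c *: lcval F.
Proof. by []. Qed.

Lemma lcval_linear (Z : seminorms (smoothfun R)) (c : R[i]) (F G : lcspace Z) :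
  lcval (c *: F + G) = c *: lcval F + lcval G.
Proof. by []. Qed.

Lemma csmooth_smoothval (f : smoothfun R) : csmooth (smoothval f).
Proof. by case: f. Qed.

Definition comp_smooth (p : {poly R}) (f : smoothfun R) : smoothfun R :=
  SmoothFun (csmooth_comp_horner p (csmooth_smoothval f)).

Lemma comp_smoothE p f : smoothval (comp_smooth p f) = smoothval f \o horner p.
Proof. by []. Qed.

Lemma smoothval_linear (c : R[i]) (f g : smoothfun R) :
  smoothval (c *: f + g) = fun x => c * smoothval f x + smoothval g x.
Proof. by []. Qed.

Lemma comp_smooth_linear p : linear (comp_smooth p).
Proof.
move=> c f g; apply: (val_inj (sT := smoothfun R)).
have := smoothval_linear c (comp_smooth p f) (comp_smooth p g).
rewrite !comp_smoothE => h; apply: etrans (esym h).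
by rewrite [LHS]comp_smoothE smoothval_linear.
Qed.

HB.instance Definition _ p :=
  GRing.isLinear.Build _ _ _ _ (comp_smooth p) (comp_smooth_linear p).

Variables (h : nat -> {poly R}).

Hypothesis bounded : forall j : sn_index Y, exists i : sn_index X,
  exists2 C : R, 0 < C & forall m f r, (X i f <= r%:E)%E ->
    (Y j (comp_smooth (h m) f) <= (C * r)%:E)%E.

Lemma sn_ge0 (Z : seminorms (smoothfun R)) i f : (0 <= Z i f)%E.
Proof.
have := sn_D (s := Z) i f (- f); rewrite subrr sn_0 -scaleN1r sn_Z normcN Normc.normc1 mul1e.
by case: (Z i f) => // x; rewrite !lee_fin; lra.
Qed.

Lemma comp_smooth_finite m (F : lcspace X) :
  comp_smooth (h m) (lcval F) \in finite_sn Y.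
Proof.
apply/asboolP => j; have [i [C C0 bC]] := bounded j.
have /asboolP /(_ i) Fi : lcval F \in finite_sn X by case: F.
apply: (@le_lt_trans _ _ (C * fine (X i (lcval F)))%:E); last exact: ltry.
by apply: bC; rewrite fineK// ge0_fin_numE// sn_ge0.
Qed.

Definition comp_lc m (F : lcspace X) : lcspace Y := LCSpace (comp_smooth_finite m F).

Lemma comp_lcE m F : lcval (comp_lc m F) = comp_smooth (h m) (lcval F).
Proof. by []. Qed.

Lemma comp_lc_linear m : linear (comp_lc m).
Proof.
move=> c F G; apply: (val_inj (sT := lcspace Y)).
have := lcval_linear c (comp_lc m F) (comp_lc m G) => E; apply: etrans (esym E).
by rewrite [LHS]comp_lcE !comp_lcE lcval_linear linearP.
Qed.

HB.instance Definition _ m :=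
  GRing.isLinear.Build _ _ _ _ (comp_lc m) (comp_lc_linear m).

(** The point is that [D] is chosen before [m]. *)
Lemma comp_lc_entourage (E : set (lcspace Y * lcspace Y)) : entourage E ->
  exists2 D : set (lcspace X * lcspace X), entourage D &
    forall m F G, D (F, G) -> E (comp_lc m F, comp_lc m G).
Proof.
move=> [s [e e0 sE]].
have /choice[i /choice[C iC]] : forall j, exists i, exists C : R, 0 < C /\
    forall m f r, (X i f <= r%:E)%E -> (Y j (comp_smooth (h m) f) <= (C * r)%:E)%E.
  by move=> j; have [i [C C0 bC]] := bounded j; exists i, C.
have C0 j : 0 <= C j by have [/ltW] := iC j.
(* [S] dominates every [C j] with [j] in [s]; the summand 1 keeps it positive and the final
   inequality strict. *)
pose S := 1 + \sum_(j <- s) C j.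
have S0 : 0 < S by rewrite ltr_wpDr// sumr_ge0.
exists (sn_ball (map i s) (e / S)); first by exists (map i s), (e / S) => //; rewrite divr_gt0.
move=> m F G FG; apply: sE => j js /=.
have -> : comp_smooth (h m) (lcval F) - comp_smooth (h m) (lcval G) =
    comp_smooth (h m) (lcval (F - G)) by rewrite lcvalB linearB.
have [_ bC] := iC j; apply: (@le_lt_trans _ _ (C j * (e / S))%:E).
  apply: bC; rewrite lcvalB; apply: ltW; apply: FG => /=; exact: map_f.
rewrite lte_fin mulrA ltr_pdivrMr// mulrC ltr_pM2l//.
rewrite /S ltr_pwDl//; elim: (s) js => [//|k t IH]; rewrite in_cons big_cons.
move=> /predU1P[->|/IH Cj]; first by rewrite lerDl sumr_ge0.
by rewrite (le_trans Cj)// lerDr.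
Qed.

Lemma equicontinuous_composition_bounded :
  equicontinuous_composition X Y (fun m => horner (h m)).
Proof.
(* The neighborhood does not depend on [m], so any index set is allowed; the full one also yields
   the continuity of each operator. *)
have equi (W : set nat) : equicontinuous W (fun m => comp_lc m : lcspace X -> lcspace Y).
  move=> F E /comp_lc_entourage[D eD DE]; apply/nbhsP; exists D => // G /=.
  by rewrite /xsection /= inE => FG m _; exact: DE.
exists (fun m => comp_lc m); split => [//|m _|]; last exact: equi.
exact: equicontinuous_continuous (equi setT) _.
Qed.

End operators.

(** * Necessity: equicontinuity excludes fixed points *)

Section lipschitz.
Variable R : realType.

Lemma derive1_bounded_lipschitz (f : R -> R) (C : R) :
    (forall x, derivable f x 1) -> (forall x, `|derive1 f x| <= C) ->
  forall x y, `|f x - f y| <= C * `|x - y|.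
Proof.
move=> df fC x y.
wlog yx : x y / y <= x.
  move=> H; have [/H//|/ltW/H] := leP y x.
  by rewrite [X in X <= _]distrC [`|y - x|]distrC.
have [| |c _ ->] := @MVT_segment R f (derive1 f) y x yx.
- by move=> z _; rewrite derive1E; exact: derivableP.
- by apply: derivable_within_continuous => z _.
by rewrite normrM ler_wpM2r.
Qed.

End lipschitz.

Lemma Re_le_cabs (R : rcfType) (z : R[i]) : `|complex.Re z| <= cabs z.
Proof. by case: z => a b /=; rewrite -sqrtr_sqr ler_wsqrtr// lerDl sqr_ge0. Qed.

Section necessity.
Variables (R : realType) (w : R -> R) (Y : seminorms (smoothfun R)).
Hypotheses (w_weight : weight w) (w_subadditive : weight_subadditive w).

Lemma cgaussian_finite :
  SmoothFun (csmooth_cgaussian R) \in finite_sn (gelfand_shilov w).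
Proof. by apply/asboolP => l; exact: gs_norm_cgaussian_fin. Qed.

Variables (j : sn_index Y) (C : R).
Hypothesis C_gt0 : 0 < C.
Hypothesis Y_C1 : forall f r, (Y j f <= r%:E)%E -> (schwartz_norm (1%N, 0%N) f <= (C * r)%:E)%E.

(** The target enters only through a seminorm controlling the supremum of [|f'|], so the argument
    covers both [S_sigma] and the Schwartz space. A small multiple [c] of the Gaussian lies in the
    neighborhood of 0 given by equicontinuity, whence the common Lipschitz constant [C / c]. *)
Lemma equicontinuous_no_fixed_point (p : {poly R}) : (2 < size p)%N ->
  equicontinuous_composition (gelfand_shilov w) Y (fun m x => iter m (horner p) x) ->
  ~ exists x, p.[x] = x.
Proof.
move=> p2 [T [TE _ Teq]] [x0 /eqP px0].
pose G := LCSpace cgaussian_finite.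
have [D [s [e e0 sD]] DG] : exists2 D : set (lcspace (gelfand_shilov w) * lcspace _),
    entourage D & forall F, D (0, F) -> forall m, (0 < m)%N ->
    (Y j (lcval (T m 0) - lcval (T m F))%R < 1%:E)%E.
  have eE : entourage (@sn_ball _ _ Y [:: j] 1) by exists [:: j], 1.
  have /nbhsP[D eD DT] := Teq 0 _ eE; exists D => // F DF m m0.
  have := DT F; rewrite /xsection /= inE => /(_ DF m m0) /(_ j) /=; apply.
  by rewrite inE.
have /= finG i : (gs_norm w i (lcval G) < +oo)%E.
  by have /asboolP /(_ i) := cgaussian_finite.
have G0 i := sn_ge0 (Z := gelfand_shilov w) i (lcval G).
pose M := 1 + \sum_(i <- s) fine (gs_norm w i (lcval G)).
have fG0 i : 0 <= fine (gs_norm w i (lcval G)) by rewrite fine_ge0// G0.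
have M0 : 0 < M by rewrite ltr_wpDr// sumr_ge0.
pose c := e / M; have c0 : 0 < c by rewrite divr_gt0.
pose z : R[i] := Complex c 0.
have cabsc : cabs z = c by rewrite cabs_real gtr0_norm.
have bnd m : (0 < m)%N -> (Y j (z *: lcval (T m G))%R < 1%:E)%E.
  move=> m0.
  (* Equicontinuity at 0 controls [T m 0 - T m F]; taking [F = - (z *: G)] gives the right sign. *)
  have -> : z *: lcval (T m G) = lcval (T m 0) - lcval (T m (- (z *: G))).
    by rewrite -lcvalB -linearB sub0r opprK linearZ lcvalZ.
  apply: DG => //; apply: sD => i si.
  rewrite -lcvalB sub0r opprK lcvalZ (@sn_Z _ _ (gelfand_shilov w)) cabsc.
  rewrite -(@fineK _ (gelfand_shilov w i (lcval G))) ?ge0_fin_numE ?G0 ?finG//.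
  rewrite -EFinM lte_fin.
  rewrite /c mulrAC ltr_pdivrMr// ltr_pM2l// /M ltr_pwDl//.
  elim: (s) si => [//|k t IH]; rewrite in_cons big_cons.
  move=> /predU1P[->|/IH h]; first by rewrite lerDl sumr_ge0.
  by rewrite (le_trans h)// lerDr.
move: px0; apply/negP.
apply: (@fixed_point_not_equi_lipschitz R p p2 (@gaussian R) (C / c)).
- exact: gaussian_gt0.
- exact: gaussian_nonincreasing_norm.
- exact: gaussian_vanishes.
- exact: divr_gt0.
move=> m.
have itE k : iter k (horner p) = horner (iter k (fun q => p \Po q) 'X).
  elim: k => [|k IH]; apply/funext => x; rewrite ?hornerX//= horner_comp -IH //.
have /= smG := csmooth_comp_horner (iter m.+1 (fun q => p \Po q) 'X) (csmooth_smoothval (lcval G)).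
have /asboolP[smR _] := smG.
apply: (@derive1_bounded_lipschitz _ (gaussian (R:=R) \o iter m.+1 (horner p))).
  move=> x; have := smR 0%N x; by rewrite itE.
move=> x; rewrite ler_pdivlMr// mulrC.
have := Y_C1 (ltW (bnd m.+1 isT)); rewrite mulr1.
rewrite schwartz_normZ cabsc => h.
rewrite -lee_fin; apply: le_trans h; rewrite EFinM lee_wpmul2l ?lee_fin ?(ltW c0)//.
have /le_trans : ((`|x| ^+ 0 * cabs (cderiv 1 (lcval (T m.+1 G)) x))%:E <=
    schwartz_norm (1%N, 0%N) (lcval (T m.+1 G)))%E.
  by apply: ereal_sup_ubound; exists x.
have /le_trans : (`|derive1 (@gaussian R \o iter m.+1 (horner p)) x|%:E <=
    (`|x| ^+ 0 * cabs (cderiv 1 (lcval (T m.+1 G)) x))%:E)%E.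
  rewrite lee_fin expr0 mul1r TE//.
  exact: (Re_le_cabs (cderiv 1 (@cgaussian R \o iter m.+1 (horner p)) x)).
by move=> h1 h2; apply: h1; apply: h2.
Qed.

End necessity.

(** * Sufficiency: uniform bounds for the iterates in the absence of fixed points *)

Section sufficiency.
Variables (R : realType) (w : R -> R).
Hypotheses (w_weight : weight w) (w_subadditive : weight_subadditive w).

Lemma leq_bin_exp2 n k : ('C(n, k) <= 2 ^ n)%N.
Proof.
elim: n k => [|n IH] [|k] //=; first by rewrite bin0 expn_gt0.
by rewrite binS expnS mul2n -addnn leq_add.
Qed.

(** The quotient is ['C(n, k) * (n - k)!]; the binomial is at most [2 ^ n] and the factorial is
    absorbed by the Young conjugate. *)
Lemma fact_ratio_le_young (l : R) n k : 0 < l -> (k <= n)%N ->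
  n`!%:R / k`!%:R <=
  expR (l * w 1) * (2 * expR (l * w 1)) ^+ n * expR (scaled_young w l (n - k)%:R).
Proof.
move=> l0 kn; have A1 : 1 <= expR (l * w 1).
  by rewrite -expR0 ler_expR mulr_ge0 ?(ltW l0)// (weight_ge0 w_weight).
rewrite ler_pdivrMr ?ltr0n ?fact_gt0//.
apply: (@le_trans _ _ (2 ^+ n * (n - k)`!%:R * k`!%:R)).
  rewrite -(bin_fact kn) -mulrA -!natrM -natrX -natrM ler_nat.
  by rewrite [(k`! * _)%N]mulnC leq_mul2r leq_bin_exp2 orbT.
rewrite ler_wpM2r// exprMn mulrCA -mulrA ler_wpM2l ?exprn_ge0//.
apply: (le_trans (fact_le_young w_weight w_subadditive (n - k) l0)).
by rewrite -exprS ler_wpM2r ?expR_ge0// ler_weXn2l// ltnS leq_subr.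
Qed.

Variables (a : R) (p : {poly R}).
Hypotheses (a_gt2 : 2 < a) (p_deg : (2 < size p)%N).
Hypothesis p_nofix : ~ exists x, p.[x] = x.

Let sigma (t : R) := w (t `^ a^-1).

Lemma horner_iter_comp m x :
  (iter m (fun q => p \Po q) 'X).[x] = iter m (horner p) x.
Proof. by elim: m => [|m IH]; rewrite ?hornerX//= horner_comp IH. Qed.

(** The radius is [r = K ^- m]. Orbits outgrow [(K ^+ N) ^+ m], so [K ^+ m] costs only the power
    [1 / N] of [1 + |y|]; rounding [n / N] up keeps the exponents integral. *)
Lemma expr_inv_le_orbit (N : nat) : (0 < N)%N ->
  exists2 C, 1 <= C & forall m x n, let y := iter m (horner p) x in
    [/\ 1 + `|x| <= C * (1 + `|y|) &
        exists r : R, [/\ 0 < r,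
          majorant r (iter m (fun q => p \Po q) 'X \Po ('X + x%:P) - y%:P) <= 1 + `|y| &
          r ^- n <= (C * (1 + `|y|)) ^+ (n %/ N).+1]].
Proof.
move=> N0; have p0 : p != 0 by rewrite -size_poly_gt0; apply: ltn_trans p_deg.
have [K K1 pK] := majorant_iter_le p0.
have K0 : 0 < K by apply: lt_le_trans K1.
have [C C1 pC] := orbit_growth p_deg p_nofix (exprn_ege1 N K1).
exists C => // m x n y; have [Cy Cx] := pC m x; split => //.
exists (K ^- m); split; first by rewrite invr_gt0 exprn_gt0.
  exact: pK.
rewrite -exprVn invrK.
apply: (@le_trans _ _ (((K ^+ N) ^+ m) ^+ (n %/ N).+1)).
  rewrite -!exprM ler_weXn2l// mulnCA leq_mul2l mulnC.
  by rewrite ltnW ?orbT// ltn_ceil.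
by rewrite lerXn2r ?nnegrE ?exprn_ge0 ?(ltW K0)// (le_trans _ Cy)// ?exprn_ge0 ?(ltW K0).
Qed.

Lemma gs_norm_comp_iter_le (l : {posnum R}) : exists mu : {posnum R},
  exists2 C, 0 < C & forall m f r, (gs_norm w mu (smoothval f) <= r%:E)%E ->
  (gs_norm sigma l (comp_smooth (iter m (fun q => p \Po q) 'X) f) <= (C * r)%:E)%E.
Proof.
have index_add (i j d : nat) : (i + (j + i + d.+1) = (2 * i + j + d).+1)%N by lia.
have index_le (i j k d : nat) : (k <= i)%N ->
  (i - k + (2 * k + j + d) <= 2 * (i + j) + d)%N by lia.
have l0 : 0 < l%:num by [].
(* The room [a - 2 = 2 * e] is split in halves: one for the powers of [1 + |y|] that pay for
   [K ^+ (m * n)], the other for geometric factors. *)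
pose e := (a - 2) / 2; have e0 : 0 < e by rewrite divr_gt0// subr_gt0.
pose Y := scaled_young w l%:num.
pose N := (Num.truncn e^-1).+1.
have Ne n : (n %/ N)%:R <= e * n%:R.
  have h : e^-1 <= N%:R by rewrite ltW// truncnS_gt.
  rewrite -ler_pdivrMl// mulrC; apply: le_trans (_ : (n %/ N)%:R * N%:R <= _).
    by rewrite ler_wpM2l.
  by rewrite -natrM ler_nat leq_trunc_div.
have [C C1 pC] := @expr_inv_le_orbit N isT.
have C0 : 0 < C by apply: lt_le_trans C1.
set A := expR (l%:num * w 1).
have A1 : 1 <= A by rewrite -expR0 ler_expR mulr_ge0// (weight_ge0 w_weight).
have A0 : 0 < A by apply: lt_le_trans A1.
(* [2 * A] comes from the factorial quotient, [C] from the orbit bounds, and a further 2 from the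
   number of terms, [n.+1 <= 2 ^+ S]. *)
have D1 : 1 <= 4 * A * C by rewrite !mulr_ege1// ler1n.
have [B B0 BP] := expr_le_young w_weight l0 e0 D1.
exists (PosNum (mulr_gt0 (ltr0Sn R 1) l0)).
exists (expR (Y 1) * A * C * B) => [|m f r fr].
  by rewrite !mulr_gt0 ?expR_gt0.
have r0 : 0 <= r.
  by rewrite -lee_fin; apply: le_trans fr; exact: (sn_ge0 (Z := gelfand_shilov w)).
apply: ge_ereal_sup => _ [x [n [q ->]]]; rewrite lee_fin.
have a0 : 0 < a by apply: lt_trans a_gt2.
rewrite young_scale_powR// mulrA -[l%:num * _]/(Y _) expRN ler_pdivrMr ?expR_gt0//.
set g := iter m _ _; set S := (n + q)%N.
have [] := pC m x n; set y := iter m _ x => xy [rho [rho0 majy rhoy]].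
have gy : g.[x] = y by exact: horner_iter_comp.
set z := 1 + `|y| in xy majy rhoy; have z1 : 1 <= z by rewrite lerDl.
have z0 : 0 < z by apply: lt_le_trans z1.
have := cderiv_comp_horner_le g n x (csmooth_smoothval f) rho0; rewrite gy -/y => fg.
pose E := expR (Y 1) * A * C * (2 * A * C) ^+ S * expR (Y ((2 + e) * S%:R)) * r.
have term (k : 'I_n.+1) : (1 + `|x|) ^+ q * (cabs (cderiv k (smoothval f) y) *
    (n`!%:R / k`!%:R * majorant rho (g \Po ('X + x%:P) - y%:P) ^+ k * rho ^- n)) <= E.
  have kn : (k <= n)%N by rewrite -ltnS.
  set c := cabs _; have c0 : 0 <= c by apply: sqrtr_ge0.
  (* The total power of [z]: [q] from the weight at [x], [k] from the majorant, the rest from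
     [rho ^- n]. The seminorm of [f] is thus used at total index [k + Q], whose summand 1 is split
     off as [Y 1] on passing from [2 * l] to [l]. *)
  pose Q := (q + k + (n %/ N).+1)%N.
  have fk : z ^+ Q * c <= r * (expR (Y 1) * expR (Y (2 * k + q + n %/ N)%N%:R)).
    have : ((z ^+ Q * c * expR (- (scaled_young w (2 * l%:num) (k + Q)%:R)))%:E <= r%:E)%E.
      by apply: le_trans fr; apply: ereal_sup_ubound; exists y, k, Q.
    rewrite lee_fin expRN ler_pdivrMr ?expR_gt0// => /le_trans; apply.
    rewrite ler_wpM2l// -expRD ler_expR.
    apply: le_trans (scaled_young_subadd w_weight l0 _ _) => //.
    rewrite le_eqVlt; apply/orP; left; apply/eqP; congr scaled_young.
    by rewrite [RHS]addrC natr1 /Q index_add.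
  have : 0 <= n`!%:R / k`!%:R :> R by rewrite divr_ge0.
  have := fact_ratio_le_young l0 kn; rewrite -/A.
  set F := _ / _ => FA F0.
  (* The [k] lost in [n - k] offsets one of the two in [2 * k]; as [k <= n], the sum is at most
     [2 * S + n / N]. *)
  have Y12 : Y (n - k)%:R + Y (2 * k + q + n %/ N)%N%:R <= Y ((2 + e) * S%:R).
    apply: (le_trans (scaled_young_superadd w_weight l0 _ _)) => //.
    apply: scaled_young_homo => //.
    rewrite -natrD mulrDl; apply: (@le_trans _ _ ((2 * S)%:R + (n %/ N)%:R)).
      by rewrite -natrD ler_nat index_le.
    rewrite natrM lerD2l; apply: (le_trans (Ne n)).
    by rewrite ler_wpM2l ?(ltW e0)// ler_nat leq_addr.
  have st1 : (1 + `|x|) ^+ q <= C ^+ q * z ^+ q.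
    by rewrite -exprMn lerXn2r ?nnegrE ?addr_ge0 ?mulr_ge0 ?(ltW C0) ?(ltW z0).
  have st2 : majorant rho (g \Po ('X + x%:P) - y%:P) ^+ k <= z ^+ k.
    by rewrite lerXn2r ?nnegrE ?majorant_ge0 ?(ltW rho0) ?(ltW z0).
  have st3 : rho ^- n <= C ^+ n.+1 * z ^+ (n %/ N).+1.
    apply: (le_trans rhoy); rewrite exprMn ler_wpM2r ?exprn_ge0 ?(ltW z0)//.
    by rewrite ler_weXn2l// ltnS leq_div.
  have zz j : 0 <= z ^+ j by rewrite exprn_ge0// ltW.
  have CC j : 0 <= C ^+ j by rewrite exprn_ge0// ltW.
  apply: (@le_trans _ _ (C ^+ q * z ^+ q * (c * (F * z ^+ k * (C ^+ n.+1 * z ^+ (n %/ N).+1))))).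
    apply: ler_pM => //.
      by rewrite !mulr_ge0 ?invr_ge0 ?exprn_ge0 ?majorant_ge0 ?(ltW rho0).
    rewrite ler_wpM2l//; apply: ler_pM => //.
    - by rewrite mulr_ge0 ?exprn_ge0 ?majorant_ge0 ?(ltW rho0).
    - by rewrite invr_ge0 exprn_ge0 ?(ltW rho0).
    by rewrite ler_wpM2l.
  have -> : C ^+ q * z ^+ q * (c * (F * z ^+ k * (C ^+ n.+1 * z ^+ (n %/ N).+1))) =
      C * C ^+ S * F * (z ^+ Q * c).
    by rewrite /Q /S !exprD exprS; ring.
  have h : F * (z ^+ Q * c) <= A * (2 * A) ^+ S * expR (Y 1) *
      expR (Y ((2 + e) * S%:R)) * r.
    apply: (le_trans (ler_pM F0 _ FA fk)); first by rewrite mulr_ge0.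
    have -> : A * (2 * A) ^+ n * expR (scaled_young w l%:num (n - k)%:R) *
       (r * (expR (Y 1) * expR (Y (2 * k + q + n %/ N)%N%:R))) =
       A * (2 * A) ^+ n * expR (Y 1) *
        expR (Y (n - k)%:R + Y (2 * k + q + n %/ N)%N%:R) * r.
      by rewrite expRD /Y; ring.
    rewrite ler_wpM2r//; apply: ler_pM; rewrite ?ler_expR ?expR_ge0//.
      by rewrite !mulr_ge0 ?expR_ge0 ?exprn_ge0 ?mulr_ge0 ?(ltW A0).
    rewrite ler_wpM2r ?expR_ge0// ler_wpM2l ?(ltW A0)// ler_weXn2l ?leq_addr//.
    by rewrite mulr_ege1// ler1n.
  rewrite -mulrA; apply: (le_trans (ler_wpM2l _ h)); first by rewrite mulr_ge0 ?CC ?(ltW C0).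
  by rewrite /E [in leRHS]exprMn le_eqVlt; apply/orP; left; apply/eqP; ring.
apply: (@le_trans _ _ ((n.+1)%:R * E)).
  apply: (le_trans (ler_wpM2l _ fg)); first by rewrite exprn_ge0// addr_ge0.
  rewrite mulr_sumr; apply: (le_trans (ler_sum _ (fun k _ => term k))).
  by rewrite sumr_const card_ord mulr_natl.
have E0 : 0 <= E by rewrite !mulr_ge0 ?exprn_ge0 ?expR_ge0 ?mulr_ge0 ?(ltW A0) ?(ltW C0).
apply: (@le_trans _ _ (2 ^+ S * E)).
  rewrite ler_wpM2r// -natrX ler_nat; apply: leq_trans (ltn_expl n (isT : (1 < 2)%N)) _.
  by rewrite leq_exp2l// leq_addr.
have -> : 2 ^+ S * E = expR (Y 1) * A * C * r * expR (Y ((2 + e) * S%:R)) * (4 * A * C) ^+ S.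
  rewrite /E (_ : 4 * A * C = 2 * (2 * A * C)); last by ring.
  by rewrite [in RHS]exprMn; ring.
have SY : expR (Y ((2 + e) * S%:R)) * (4 * A * C) ^+ S <= B * expR (Y (a * S%:R)).
  apply: (le_trans (ler_wpM2l (expR_ge0 _) (BP S))).
  rewrite mulrCA ler_wpM2l ?(ltW B0)// -expRD ler_expR.
  apply: (le_trans (scaled_young_superadd w_weight l0 _ _)).
  - by rewrite mulr_ge0// addr_ge0 ?(ltW e0).
  - by rewrite mulr_ge0 ?(ltW e0).
  by rewrite -mulrDl /Y (_ : 2 + e + e = a)// /e; field.
rewrite -mulrA; apply: (le_trans (ler_wpM2l _ SY)).
  by rewrite !mulr_ge0 ?expR_ge0 ?(ltW A0) ?(ltW C0).
by rewrite le_eqVlt; apply/orP; left; apply/eqP; ring.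
Qed.

End sufficiency.

(** Each Schwartz seminorm is controlled by the entries of the Gelfand-Shilov norm with one fixed
    pair of indices, whose weight becomes the constant. *)
Lemma schwartz_norm_le_gs (R : realType) (w : R -> R) (l : {posnum R}) nq :
  exists2 C, 0 < C & forall f r, (gs_norm w l f <= r%:E)%E ->
    (schwartz_norm nq f <= (C * r)%:E)%E.
Proof.
exists (expR (l%:num * young w ((nq.1 + nq.2)%:R / l%:num))) => [|f r fr].
  exact: expR_gt0.
apply: ge_ereal_sup => _ [x ->]; rewrite lee_fin [leRHS]mulrC -ler_pdivrMr ?expR_gt0// -expRN.
rewrite -lee_fin; apply: (@le_trans _ _ ((1 + `|x|) ^+ nq.2 * cabs (cderiv nq.1 f x) *
     expR (- (l%:num * young w ((nq.1 + nq.2)%:R / l%:num))))%:E).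
  rewrite lee_fin ler_wpM2r ?expR_ge0// ler_wpM2r ?sqrtr_ge0//.
  by rewrite lerXn2r ?nnegrE ?addr_ge0// lerDr.
by apply: le_trans fr; apply: ereal_sup_ubound; exists x, nq.1, nq.2.
Qed.

Theorem theorem3p3 (R : realType) (omega : R -> R)
    (omega_weight : weight omega) (omega_subadditive : weight_subadditive omega)
    (a : R) (a_gt2 : 2 < a) (psi : {poly R}) (psi_deg : (2 < size psi)%N) :
  let sigma := fun t : R => omega (t `^ a^-1) in
  let psi_ := fun (m : nat) (x : R) => iter m (horner psi) x in
  [<-> equicontinuous_composition (gelfand_shilov omega) (gelfand_shilov sigma) psi_;
       equicontinuous_composition (gelfand_shilov omega) (schwartz R) psi_;
       ~ exists x : R, psi.[x] = x].
Proof.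
move=> sigma psi_.
pose h m := iter m (fun q => psi \Po q) 'X.
have hE : (fun m => horner (h m)) = psi_.
  by apply/funext => m; apply/funext => x; exact: horner_iter_comp.
have sufficient : (~ exists x : R, psi.[x] = x) ->
    equicontinuous_composition (gelfand_shilov omega) (gelfand_shilov sigma) psi_ /\
    equicontinuous_composition (gelfand_shilov omega) (schwartz R) psi_.
  move=> nofix; have bound := gs_norm_comp_iter_le omega_weight omega_subadditive
    a_gt2 psi_deg nofix.
  rewrite -hE; split; apply: equicontinuous_composition_bounded.
    by move=> l; have [mu [C C0 bC]] := bound l; exists mu; exists C.
  move=> nq; have [mu [C C0 bC]] := bound 1%:pos.
  have [D D0 bD] := schwartz_norm_le_gs sigma 1%:pos nq.
  exists mu; exists (D * C); first exact: mulr_gt0.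
  by move=> m f r /bC /bD fr; rewrite -mulrA; exact: fr.
have necessary (Y : seminorms (smoothfun R)) (j : sn_index Y) (C : R) : 0 < C ->
    (forall f r, (Y j f <= r%:E)%E -> (schwartz_norm (1%N, 0%N) f <= (C * r)%:E)%E) ->
    equicontinuous_composition (gelfand_shilov omega) Y psi_ ->
    ~ exists x : R, psi.[x] = x.
  by move=> C0 YC; exact: equicontinuous_no_fixed_point YC _ psi_deg.
(* The implication from (1) to (2) passes through (3). *)
tfae.
- have [D D0 bD] := schwartz_norm_le_gs sigma 1%:pos (1%N, 0%N).
  by move=> /(@necessary (gelfand_shilov sigma) 1%:pos D D0 (fun f => bD f)) /sufficient[].
- by apply: (@necessary (schwartz R) (1%N, 0%N) 1) => // f r; rewrite mul1r.
- by move=> /sufficient[].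
Qed.
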